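(* Let $\mathcal B\subseteq\mathbb N$ be an infinite primitive set, with associated $H$, $\Delta$, $W$, $\varphi$, $\eta$, $X_\eta$, $M$, $C_\varphi$, $\mathcal A_S$, $\mathcal A_\infty$. Consider the following properties: (B1) The window $W$ is topologically regular, i.e. $\overline{\operatorname{int}(W)}=W$. (B2) $\mathcal F_{\mathcal B}=\bigcup_{S\subset\mathcal B\text{ finite}}\mathcal F_{\mathcal A_S}$. (B3) $\mathcal A_\infty=\emptyset$. (B4) There are no $d\in\mathbb N$ and no infinite pairwise coprime set $\mathcal A\subseteq\mathbb N\setminus\{1\}$ such that $d\,\mathcal A\subseteq\mathcal B$. (B5) $\eta=\varphi(0)$ is a Toeplitz sequence different from $(\dots,0,0,0,\dots)$. (B6) $0\in C_\varphi$ and $\varphi(0)\neq(\dots,0,0,0,\dots)$. (B7) $\eta\in M$ and $\eta\neq(\dots,0,0,0,\dots)$. (B8) $X_\eta$ is minimal, i.e. $X_\eta=M$, and $\operatorname{card}(X_\eta)>1$. (B9) The dynamics $(X_\eta,\sigma)$ is a minimal almost 1-1 extension of $(H,R_{\Delta(1)})$, the rotation by $\Delta(1)$ on $H$. Then: a) (B1)–(B6) are all equivalent, and each of these conditions implies that $\mathcal B$ is taut. b) (B7) and (B8) are equivalent. c) Each of (B1)–(B6) implies (B9). d) (B9) implies (B7) and (B8). e) If $\overline{\Delta(\mathbb Z)\cap W}=W$ (in particular if $\mathcal B$ is taut), then (B1)–(B9) are all equivalent.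
   Context: $\mathbb N=\{1,2,\dots\}$. For $A\subseteq\mathbb N$ let $\mathcal M_A=\bigcup_{a\in A}a\mathbb Z$ and $\mathcal F_A=\mathbb Z\setminus\mathcal M_A$. $\mathcal B$ is primitive if there are no distinct $b,b'\in\mathcal B$ with $b\mid b'$. $\mathcal B$ is taut if $\boldsymbol\delta(\mathcal M_{\mathcal B\setminus\{b\}})<\boldsymbol\delta(\mathcal M_{\mathcal B})$ for each $b\in\mathcal B$, where $\boldsymbol\delta(\mathcal M)=\lim_{n\to\infty}\frac1{\log n}\sum_{1\le k\le n,\,k\in\mathcal M}\frac1k$ is logarithmic density (it exists for all sets of multiples by Davenport–Erdős). $\Delta:\mathbb Z\to\prod_{b\in\mathcal B}\mathbb Z/b\mathbb Z$, $\Delta(n)=(n \bmod b)_{b\in\mathcal B}$; $H:=\overline{\Delta(\mathbb Z)}$ is a compact abelian group (product topology); $R_{\Delta(1)}:H\to H$, $h\mapsto h+\Delta(1)$; the window is $W:=\{h\in H: h_b\neq 0\ \forall b\in\mathcal B\}$; $\operatorname{int}(W)$ is its interior in $H$. The coding map $\varphi:H\to\{0,1\}^{\mathbb Z}$ is given by $\varphi(h)(n)=1$ iff $h+\Delta(n)\in W$, and $C_\varphi\subseteq H$ is the set of points at which $\varphi$ is continuous (product topology on $\{0,1\}^{\mathbb Z}$). $\eta=\varphi(0)$ is the indicator function of $\mathcal F_{\mathcal B}$; $\sigma$ is the left shift on $\{0,1\}^{\mathbb Z}$; $X_\eta=\overline{\{\sigma^n\eta:n\in\mathbb Z\}}$.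 It is known that $(X_\eta,\sigma)$ has a unique minimal subset, denoted $M$. For finite $S\subset\mathcal B$: $\mathcal A_S:=\{\gcd(b,\operatorname{lcm}(S)):b\in\mathcal B\}$. $\mathcal A_\infty:=\{n\in\mathbb N:\ \text{for every finite }S\subset\mathcal B\text{ there is a finite }S'\subset\mathcal B\text{ with }S\subseteq S'\text{ and }n\in\mathcal A_{S'}\setminus S'\}$. A sequence $x\in\{0,1\}^{\mathbb Z}$ is Toeplitz if for every $n\in\mathbb Z$ there is $m\in\mathbb N$ with $x(n+jm)=x(n)$ for all $j\in\mathbb Z$. $(X_\eta,\sigma)$ is a minimal almost 1-1 extension of $(H,R_{\Delta(1)})$ if $(X_\eta,\sigma)$ is minimal and there is a continuous surjection $\pi:X_\eta\to H$ with $\pi\circ\sigma=R_{\Delta(1)}\circ\pi$ such that $\pi^{-1}\{h\}$ is a singleton for some $h\in H$ (equivalently, by minimality, for a dense $G_\delta$ set of $h$). *)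

(* Defs.v *)
From HB Require Import structures.
From mathcomp Require Import all_boot all_order all_algebra.
From mathcomp Require Import finmap.
From mathcomp Require Import all_classical all_reals all_analysis.

Set Implicit Arguments.
Unset Strict Implicit.
Unset Printing Implicit Defensive.

Import Order.TTheory GRing.Theory Num.Theory.
Import numFieldNormedType.Exports.

Local Open Scope classical_set_scope.
Local Open Scope ring_scope.

(* Subsets of N = {1, 2, ...} are sets of type [set nat]; positivity of their
   elements is a hypothesis wherever it matters. *)

Definition multiples (A : set nat) : set int :=
  [set n | exists2 a, A a & (a%:Z %| n)%Z].

Definition free_numbers (A : set nat) : set int := ~` multiples A.

Definition primitive (B : set nat) : Prop :=
  forall b b', B b -> B b' -> b != b' -> ~~ (b %| b')%N.

(* [limn] is total: it is the limit when the sequence converges. *)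
Definition log_density (R : realType) (M : set int) : R :=
  limn (fun n : nat =>
    (ln n%:R)^-1 * \sum_(1 <= k < n.+1 | k%:Z \in M) (k%:R : R)^-1).

Definition taut (R : realType) (B : set nat) : Prop :=
  forall b, B b ->
    log_density R (multiples (B `\ b)) < log_density R (multiples B).

(* For b >= 1 the type 'I_b.-1.+1 is 'I_b with its canonical additive group
   structure, i.e. Z/bZ (this also holds for b = 1, unlike 'Z_b). *)
Definition residues (B : set nat) : Type :=
  prod_topology (fun b : B => discrete_topology 'I_(\val b).-1.+1).

HB.instance Definition _ (B : set nat) := Topological.on (residues B).

Section ResiduesGroup.
Variable B : set nat.
Implicit Types g h k : residues B.

Let Zb (b : B) : zmodType := 'I_(\val b).-1.+1.

Definition residues_zero : residues B := fun b => (0 : Zb b).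
Definition residues_opp h : residues B := fun b => - (h b : Zb b).
Definition residues_add g h : residues B :=
  fun b => (g b : Zb b) + (h b : Zb b).

Lemma residues_addA : associative residues_add.
Proof.
by move=> g h k; apply/functional_extensionality_dep => b; exact: addrA.
Qed.

Lemma residues_addC : commutative residues_add.
Proof.
by move=> g h; apply/functional_extensionality_dep => b; exact: addrC.
Qed.

Lemma residues_add0 : left_id residues_zero residues_add.
Proof.
by move=> h; apply/functional_extensionality_dep => b; exact: add0r.
Qed.

Lemma residues_addN : left_inverse residues_zero residues_opp residues_add.
Proof.
by move=> h; apply/functional_extensionality_dep => b; exact: addNr.
Qed.

HB.instance Definition _ := GRing.isZmodule.Build (residues B)
  residues_addA residues_addC residues_add0 residues_addN.

End ResiduesGroup.

Section Window.
Variable B : set nat.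

Definition Delta (n : int) : residues B :=
  fun b => inZp `|(n %% (\val b)%:Z)%Z|%N.

(* [group_H] is kept as a subset of the product; its own topology is that of
   [subspace group_H]. *)
Definition group_H : set (residues B) := closure (range Delta).

Definition rotation (h : residues B) : residues B := h + Delta 1.

Definition window : set (residues B) :=
  [set h | group_H h /\ forall b : B, h b <> (0 : 'I_(\val b).-1.+1)].

(* Interior relative to H. *)
Definition int_window : set (residues B) := @interior (subspace group_H) window.

Definition phi (h : residues B) : {ptws int -> bool} :=
  fun n => (h + Delta n) \in window.

(* Points of H at which the restriction of phi to H is continuous. *)
Definition C_phi : set (residues B) :=
  [set h | group_H h /\ phi x @[x --> (h : subspace group_H)] --> phi h].

Definition eta_seq : {ptws int -> bool} := phi 0.

End Window.

Arguments Delta B n : clear implicits.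
Arguments group_H B : clear implicits.
Arguments window B : clear implicits.
Arguments int_window B : clear implicits.
Arguments C_phi B : clear implicits.
Arguments eta_seq B : clear implicits.

(* [shift_by k] is the k-th power of the left shift, for k in Z. *)
Definition shift_by (k : int) (x : {ptws int -> bool}) : {ptws int -> bool} :=
  fun n => x (n + k).

Definition sigma : {ptws int -> bool} -> {ptws int -> bool} := shift_by 1.

Definition zero_seq : {ptws int -> bool} := fun=> false.

Definition X_eta (B : set nat) : set {ptws int -> bool} :=
  closure (range (fun k : int => shift_by k (eta_seq B))).

Definition subsystem (X : set {ptws int -> bool}) : Prop :=
  [/\ closed X, X !=set0 & sigma @` X = X].

Definition minimal_subset (X M : set {ptws int -> bool}) : Prop :=
  [/\ M `<=` X, subsystem M
    & forall N, N `<=` M -> subsystem N -> N = M].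

Definition minimal_system (X : set {ptws int -> bool}) : Prop :=
  minimal_subset X X.

(* The unique minimal subset of X_eta; [xget] picks one satisfying the
   predicate, and set0 if there were none. *)
Definition minimal_M (B : set nat) : set {ptws int -> bool} :=
  xget set0 [set N | minimal_subset (X_eta B) N].

Definition toeplitz (x : {ptws int -> bool}) : Prop :=
  forall n : int, exists2 m : nat,
    (0 < m)%N & forall j : int, x (n + j * m%:Z) = x n.

Definition minimal_almost_11_extension (B : set nat) : Prop :=
  minimal_system (X_eta B) /\
  exists pi : {ptws int -> bool} -> residues B,
    [/\ {within X_eta B, continuous pi},
        pi @` X_eta B = group_H B,
        {in X_eta B, forall x, pi (sigma x) = rotation (pi x)}
      & exists2 h, group_H B h
          & exists x, X_eta B `&` pi @^-1` [set h] = [set x]].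

(* Finite subsets of B are the S : {fset nat} with [set` S] `<=` B. *)
Definition lcm_fset (S : {fset nat}) : nat := \big[lcmn/1%N]_(b <- S) b.

Definition A_ (B : set nat) (S : {fset nat}) : set nat :=
  [set gcdn b (lcm_fset S) | b in B].

Definition A_infty (B : set nat) : set nat :=
  [set n | (0 < n)%N /\
    forall S : {fset nat}, [set` S] `<=` B ->
      exists S' : {fset nat},
        [/\ [set` S'] `<=` B, [set` S] `<=` [set` S'], A_ B S' n
          & n \notin S']].

Definition pairwise_coprime (A : set nat) : Prop :=
  forall a a', A a -> A a' -> a != a' -> coprime a a'.

(* Main.v *)
(* (B2)-(B6) are compared through the pointwise form of (B2): every free n lies
   in some F_{A_S}, i.e. n + lcm(S) Z consists of free numbers, i.e. Delta(n) is
   interior to W.  If d A is contained in B with A infinite and pairwise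
   coprime, then for every S some gcd(d a, lcm S) divides d, so no multiple of d
   lies in any F_{A_S}; conversely such a set is extracted greedily from an
   element of A_infty.

   The only implication for which this is not enough is (B2) => (B1), which
   needs Delta(Z) dense in W, and hence tautness.  Both halves of the argument
   (B4 implies taut, taut implies Delta(Z) dense in W) rest on Harris'
   correlation inequality for functions of gcd(i, N), i uniform modulo N, that
   are monotone along divisibility.  It yields Behrend's inequality for finite
   sets of multiples, and also
     sum_{k <= x, k free} 1/k >= (sum_{k <= x} 1/k) * (density of the free set),
   because [d <= x] is decreasing along divisibility; this is the
   Davenport-Erdos theorem, in the form: the logarithmic density of M_B is the
   supremum of the densities of M_s over the finite subsets s of B.

   Given density of Delta(Z) in W, every nonzero class modulo b contains a free
   number.  Hence if eta is Toeplitz, a finite window of a translate of eta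
   determines the translation modulo b, which defines the factor map to H; and
   if d A is contained in B as above, the points of X_eta that vanish on a
   progression of difference d form a proper nonempty subsystem. *)
Require Import Defs.
From HB Require Import structures.
From mathcomp Require Import all_boot all_order all_algebra.
From mathcomp Require Import finmap.
From mathcomp Require Import all_classical all_reals all_analysis.
From mathcomp Require Import ring lra zify.

Set Implicit Arguments.
Unset Strict Implicit.
Unset Printing Implicit Defensive.

Import Order.TTheory GRing.Theory Num.Theory.
Import numFieldNormedType.Exports.

Local Open Scope classical_set_scope.
Local Open Scope ring_scope.

(** * Harris' inequality and finite sets of multiples *)

Section CyclicSums.
Variable R : nmodType.

Lemma crt_sum (m n : nat) (F : nat -> nat -> R) : (0 < m)%N -> (0 < n)%N ->
  coprime m n ->
  \sum_(k < m * n) F (k %% m)%N (k %% n)%N = \sum_(i < m) \sum_(j < n) F i j.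
Proof.
move=> m0 n0 co_mn; rewrite pair_bigA /=.
have mn0 : (0 < m * n)%N by rewrite muln_gt0 m0.
pose split (k : 'I_(m * n)) :=
  (Ordinal (ltn_pmod k m0), Ordinal (ltn_pmod k n0)).
pose join (d : 'I_m * 'I_n) :=
  Ordinal (ltn_pmod (chinese m n d.1 d.2) mn0).
rewrite (reindex split) //; exists join => [k _|[i j] _].
  by apply: val_inj; rewrite /= -chinese_mod // modn_small.
by congr (_, _); apply: val_inj;
  rewrite /= ?(modn_dvdm _ (dvdn_mulr _ (dvdnn _)))
             ?(modn_dvdm _ (dvdn_mull _ (dvdnn _)))
             ?chinese_modl ?chinese_modr ?modn_small.
Qed.

Lemma sum_periodic (e L : nat) (f : nat -> R) :
  (forall i, f (i + L)%N = f i) ->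
  \sum_(i < e * L) f i = (\sum_(i < L) f i) *+ e.
Proof.
move=> fL; have fkL k i : f (i + k * L)%N = f i.
  elim: k => [|k IH]; first by rewrite mul0n addn0.
  by rewrite mulSn addnCA addnC fL IH.
elim: e => [|e IH]; first by rewrite mul0n big_ord0 mulr0n.
rewrite mulSn addnC big_split_ord /= IH mulrSr; congr (_ + _).
by apply: eq_bigr => i _; rewrite addnC fkL.
Qed.

Lemma sum_multiples (d K : nat) (f : nat -> R) : (0 < d)%N ->
  (forall i, ~~ (d %| i)%N -> f i = 0) ->
  \sum_(i < d * K) f i = \sum_(j < K) f (d * j)%N.
Proof.
move=> d0 f0; elim: K => [|K IH]; first by rewrite muln0 !big_ord0.
rewrite mulnS addnC big_split_ord /= IH big_ord_recr /=; congr (_ + _).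
rewrite (bigD1 (Ordinal d0)) //= addn0 big1 ?addr0 // => i /negPf i0.
apply: f0; rewrite dvdn_addr ?dvdn_mulr //.
by rewrite /dvdn modn_small // -(inj_eq val_inj) /= in i0 *; rewrite i0.
Qed.

End CyclicSums.

Lemma gcdn_coprimeM (k m n : nat) : coprime m n ->
  gcdn k (m * n) = (gcdn k m * gcdn k n)%N.
Proof.
move=> co_mn; apply/eqP; rewrite eqn_dvd; apply/andP; split.
  set G := gcdn k (m * n).
  rewrite muln_gcdl !muln_gcdr !(dvdn_gcd G).
  have Gk : (G %| k)%N := dvdn_gcdl _ _.
  have Gmn : (G %| m * n)%N := dvdn_gcdr _ _.
  by rewrite Gmn [(m * k)%N]mulnC !dvdn_mulr.
rewrite Gauss_dvd; last first.
  exact: coprime_dvdl (dvdn_gcdr _ _) (coprime_dvdr (dvdn_gcdr _ _) co_mn).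
by rewrite !dvdn_gcd !dvdn_gcdl dvdn_mulr ?dvdn_mull ?dvdn_gcdr.
Qed.

Section Harris.
Variable R : realFieldType.

(** For similarly ordered families each product [(a i - a j) * (b i - b j)] is nonnegative, and the
    double sum of these products is twice the difference of the two sides. *)
Lemma chebyshev_sum (n : nat) (a b : 'I_n -> R) :
  (forall i j, (a i <= a j /\ b i <= b j) \/ (a j <= a i /\ b j <= b i)) ->
  (\sum_i a i) * (\sum_i b i) <= n%:R * \sum_i a i * b i.
Proof.
move=> ab.
have : 0 <= \sum_i \sum_j (a i - a j) * (b i - b j).
  apply: sumr_ge0 => i _; apply: sumr_ge0 => j _.
  by case: (ab i j) => -[aij bij];
    [rewrite -mulrNN mulr_ge0 ?oppr_ge0 ?subr_le0 |
     rewrite mulr_ge0 ?subr_ge0].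
have -> : \sum_i \sum_j (a i - a j) * (b i - b j) =
    (n%:R * \sum_i a i * b i - (\sum_i a i) * (\sum_i b i)) *+ 2.
  under eq_bigr => i _.
    have -> : \sum_j (a i - a j) * (b i - b j) = n%:R * (a i * b i)
        + \sum_j a j * b j - (a i * (\sum_j b j) + (\sum_j a j) * b i).
      rewrite mulr_sumr mulr_suml -[n in n%:R]card_ord mulr_natl -sumr_const.
      rewrite -!big_split -sumrB; apply: eq_bigr => j _ /=; ring.
    over.
  rewrite sumrB !big_split /= -!mulr_sumr -!mulr_suml sumr_const card_ord.
  rewrite -mulr_natl; ring.
by rewrite pmulrn_lge0 // subr_ge0.
Qed.

Definition div_monotone (N : nat) (f : nat -> R) :=
  forall d e, (d %| e)%N -> (e %| N)%N -> f d <= f e.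

(** Induction on [N], splitting off the full power [q] of a prime. By the Chinese remainder theorem
    the residues modulo [q] and modulo [M] vary independently. The induction hypothesis treats [M]
    for each fixed residue modulo [q]; Chebyshev's inequality treats [q], whose divisors form a
    chain. *)
Lemma harris (N : nat) (f g : nat -> R) : (0 < N)%N ->
  div_monotone N f -> div_monotone N g ->
  (\sum_(i < N) f (gcdn i N)) * (\sum_(i < N) g (gcdn i N)) <=
    N%:R * \sum_(i < N) f (gcdn i N) * g (gcdn i N).
Proof.
have [n] := ubnP N; elim: n N f g => // n IH N f g ltNn N0 fN gN.
have [N1|N1] := leqP N 1.
  have -> : N = 1%N by lia.
  by rewrite !big_ord_recl !big_ord0 !addr0 mul1r.
pose p := pdiv N; pose q := (N`_p)%N; pose M := (N`_p^')%N.
have pP : prime p by rewrite pdiv_prime.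
have qM : (q * M)%N = N by rewrite partnC.
have q0 : (0 < q)%N by rewrite part_gt0.
have M0 : (0 < M)%N by rewrite part_gt0.
have coqM : coprime q M by rewrite coprime_partC.
have q1 : (1 < q)%N.
  rewrite /q p_part -(expn0 p) ltn_exp2l ?prime_gt1 //.
  by rewrite logn_gt0 mem_primes pP N0 pdiv_dvd.
have MN : (M < N)%N by rewrite -qM -{1}[M]mul1n ltn_pmul2r.
have split F : \sum_(i < N) F (gcdn i N) =
    \sum_(i < q) \sum_(j < M) F (gcdn i q * gcdn j M)%N :> R.
  rewrite -(crt_sum (fun i j => F (gcdn i q * gcdn j M)%N)) // qM.
  apply: eq_bigr => k _; rewrite !gcdn_modl; congr F.
  by rewrite -gcdn_coprimeM // qM.
pose fi (i : nat) e := f (gcdn i q * e)%N.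
pose gi (i : nat) e := g (gcdn i q * e)%N.
pose A (i : 'I_q) := \sum_(j < M) fi i (gcdn j M).
pose C (i : 'I_q) := \sum_(j < M) gi i (gcdn j M).
have mono F i : div_monotone N F -> div_monotone M (fun e => F (gcdn i q * e)%N).
  move=> FN d e de eM; apply: FN; first by rewrite dvdn_mul.
  by rewrite -qM dvdn_mul // dvdn_gcdr.
have chain F i j : div_monotone N F -> (gcdn i q %| gcdn j q)%N ->
    \sum_(k < M) F (gcdn i q * gcdn k M)%N <=
    \sum_(k < M) F (gcdn j q * gcdn k M)%N.
  move=> FN ij; apply: ler_sum => k _; apply: FN; first by rewrite dvdn_mul.
  by rewrite -qM dvdn_mul // dvdn_gcdr.
rewrite !split -/fi -/gi.
apply: (le_trans (chebyshev_sum (a := A) (b := C) _)).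
  move=> i j.
  have : (gcdn i q %| gcdn j q)%N \/ (gcdn j q %| gcdn i q)%N.
    have /dvdn_pfactor-/(_ pP)[s _ ->] : (gcdn i q %| p ^ logn p N)%N.
      by rewrite -p_part dvdn_gcdr.
    have /dvdn_pfactor -/(_ pP)[t _ ->] : (gcdn j q %| p ^ logn p N)%N.
      by rewrite -p_part dvdn_gcdr.
    by case/orP: (leq_total s t) => st; [left|right]; apply: dvdn_exp2l.
  by case=> ij; [left|right]; split; apply: chain.
have /= -> := split (fun d => f d * g d).
rewrite -{1}qM natrM -mulrA ler_wpM2l ?ler0n //.
rewrite mulr_sumr; apply: ler_sum => i _; apply: IH => //; try exact: mono.
by apply: leq_trans MN _; rewrite -ltnS.
Qed.
End Harris.

(** * Densities of the integers free of a finite list of divisors *)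

Section FreeDensity.
Variable R : realFieldType.
Implicit Types s : seq nat.

Definition nodiv s (i : nat) : bool := all (fun a => ~~ (a %| i)%N) s.

(** The product serves as a period; for positive elements, any positive common multiple gives the
    same proportion by [sum_nodiv]. *)
Definition free_density s : R :=
  (\sum_(i < \prod_(a <- s) a) (nodiv s i)%:R) / (\prod_(a <- s) a)%:R.

Lemma nodivP s i : reflect (forall a, a \in s -> ~~ (a %| i)%N) (nodiv s i).
Proof. exact: allP. Qed.

Lemma nodiv_dvd s d e : (d %| e)%N -> nodiv s e -> nodiv s d.
Proof.
move=> de /nodivP se; apply/nodivP => a /se; apply: contra => ad.
exact: dvdn_trans ad de.
Qed.

Lemma nodivD s N i : (forall a, a \in s -> a %| N)%N ->
  nodiv s (i + N) = nodiv s i.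
Proof. by move=> sN; apply: eq_in_all => a /sN aN; rewrite dvdn_addl. Qed.

Lemma nodiv_gcd s N i : (forall a, a \in s -> a %| N)%N ->
  nodiv s (gcdn i N) = nodiv s i.
Proof.
by move=> sN; apply: eq_in_all => a /sN aN; rewrite dvdn_gcd aN andbT.
Qed.

Lemma dvdn_prod_mem s a : a \in s -> (a %| \prod_(a <- s) a)%N.
Proof. by move=> sa; rewrite (big_rem a) //= dvdn_mulr. Qed.

Lemma prod_seq_gt0 s : (forall a, a \in s -> 0 < a)%N ->
  (0 < \prod_(a <- s) a)%N.
Proof. by move=> s0; rewrite big_seq prodn_cond_gt0. Qed.

(** Both [N] and the product [L] are periods of the indicator, so a count over [L * N] points can be
    cut into periods of either length. *)
Lemma sum_nodiv s N : (forall a, a \in s -> 0 < a)%N ->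
  (forall a, a \in s -> a %| N)%N ->
  \sum_(i < N) (nodiv s i)%:R = N%:R * free_density s :> R.
Proof.
move=> /prod_seq_gt0 s0 sN; rewrite /free_density.
set L := (\prod_(a <- s) a)%N in s0 *.
have LN0 : L%:R != 0 :> R by rewrite pnatr_eq0 -lt0n.
have : \sum_(i < L * N) (nodiv s i)%:R = \sum_(i < N * L) (nodiv s i)%:R :> R.
  by rewrite mulnC.
rewrite (@sum_periodic _ L N (fun i => (nodiv s i)%:R)); last first.
  by move=> i; rewrite nodivD.
rewrite (@sum_periodic _ N L (fun i => (nodiv s i)%:R)); last first.
  by move=> i; rewrite nodivD // => a; apply: dvdn_prod_mem.
move=> SL; apply: (mulfI LN0); rewrite [RHS]mulrCA [X in _ = _ * X]mulrC divfK //.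
by rewrite !mulr_natl.
Qed.

Lemma free_density_ge0 s : 0 <= free_density s.
Proof. by rewrite /free_density mulr_ge0 ?invr_ge0 ?ler0n ?sumr_ge0. Qed.

Lemma free_density_gt0 s : (forall a, a \in s -> 1 < a)%N ->
  0 < free_density s.
Proof.
move=> s1; have s0 : (0 < \prod_(a <- s) a)%N.
  by apply: prod_seq_gt0 => a /s1 /ltnW.
rewrite /free_density divr_gt0 ?ltr0n //.
have i0 := ltn_pmod 1 s0.
rewrite (bigD1 (Ordinal i0)) //= ltr_wpDr ?sumr_ge0 // ltr0n lt0b.
apply/nodivP => a sa; have a1 := s1 a sa.
rewrite /dvdn modn_dvdm ?dvdn_prod_mem //.
by rewrite modn_small.
Qed.

Lemma free_density_subset s1 s2 : (forall a, a \in s2 -> 0 < a)%N ->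
  {subset s1 <= s2} -> free_density s2 <= free_density s1.
Proof.
move=> s0 s12; have N0 := prod_seq_gt0 s0.
rewrite -(ler_pM2l (_ : 0 < (\prod_(a <- s2) a)%N%:R)) ?ltr0n //.
rewrite -(@sum_nodiv s2) //; last exact: dvdn_prod_mem.
rewrite -(@sum_nodiv s1); first last.
- by move=> a /s12; apply: dvdn_prod_mem.
- by move=> a /s12 /s0.
apply: ler_sum => i _; rewrite ler_nat; case: nodivP => // H.
by case: nodivP => // -[]; move=> a /s12; apply: H.
Qed.

(* The indicator of the free numbers and [d |-> [d <= x] / (d c(d))], where
   [c(d)/N] is the probability that [gcd(i, N) = d], both decrease along
   divisibility, so Harris' inequality applies to them. *)
Lemma log_sum_nodiv s (x : nat) : (forall a, a \in s -> 0 < a)%N ->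
  (\sum_(1 <= k < x.+1) k%:R^-1) * free_density s <=
  \sum_(1 <= k < x.+1) (nodiv s k)%:R / k%:R :> R.
Proof.
(* The factorial makes every positive [d <= x] a divisor of [N]. *)
move=> s0; pose N := (x`! * \prod_(a <- s) a)%N.
have N0 : (0 < N)%N by rewrite muln_gt0 fact_gt0 prod_seq_gt0.
have NR0 : N%:R != 0 :> R by rewrite pnatr_eq0 -lt0n.
have sN a : a \in s -> (a %| N)%N by move=> sa; rewrite dvdn_mull ?dvdn_prod_mem.
have xN d : (0 < d <= x)%N -> (d %| N)%N.
  by move=> dx; rewrite dvdn_mulr // dvdn_fact.
pose c d : R := \sum_(i < N) (gcdn i N == d)%:R.
have c0 d : (d %| N)%N -> 0 < c d.
  move=> dN; rewrite /c (bigD1 (Ordinal (ltn_pmod d N0))) //= gcdn_modl.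
  by rewrite (gcdn_idPl dN) eqxx ltr_wpDr ?sumr_ge0.
have cE d K : (0 < d)%N -> N = (d * K)%N ->
    c d = \sum_(j < K) (coprime j K)%:R.
  move=> d0 NE; rewrite /c NE.
  rewrite (@sum_multiples _ d K (fun i => (gcdn i (d * K) == d)%:R)) //.
    apply: eq_bigr => j _.
    by rewrite -muln_gcdr -{2}[d]muln1 eqn_pmul2l.
  move=> i; case: eqP => // <-; rewrite dvdn_gcdl //.
(* With [e = t * d] and [N = M * e], coprimality to [t * M] implies coprimality to [M], and the
   range [t * M] consists of [t] periods of the latter. *)
have c_mono d e : (0 < d)%N -> (d %| e)%N -> (e %| N)%N ->
    d%:R * c d <= e%:R * c e.
  move=> d0 /dvdnP[t et] /dvdnP[M NM].
  have [t0 M0] : (0 < t)%N /\ (0 < M)%N.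
    by move: N0; rewrite NM et !muln_gt0 => /andP[-> /andP[->]].
  rewrite (cE d (t * M)%N) //; last by rewrite NM et mulnC mulnAC mulnC mulnA.
  have e0 : (0 < e)%N by rewrite et muln_gt0 t0.
  rewrite (cE e M) //; last by rewrite NM mulnC.
  rewrite et natrM -mulrA [leRHS]mulrCA ler_wpM2l ?ler0n //.
  rewrite mulr_natl -(@sum_periodic _ t M (fun j => (coprime j M)%:R)).
    apply: ler_sum => j _; rewrite ler_nat.
    by rewrite coprimeMr; case: (coprime j M); rewrite ?andbF ?leq_b1.
  by move=> i; rewrite coprime_sym /coprime gcdnDr -/(coprime M i) coprime_sym.
pose h d : R := ((0 < d <= x)%N)%:R / (d%:R * c d).
(* Grouping the [i] by the value [d] of [gcd(i, N)] cancels [c d] and leaves a logarithmic sum. *)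
have sum_h (F : nat -> R) : \sum_(i < N) F (gcdn i N) * h (gcdn i N) =
    \sum_(1 <= d < x.+1) F d / d%:R.
  transitivity (\sum_(i < N) \sum_(1 <= d < x.+1)
      (gcdn i N == d)%:R * (F d / (d%:R * c d))).
    apply: eq_bigr => i _; rewrite /h.
    have [dx|dx] := boolP (0 < gcdn i N <= x)%N.
      rewrite (big_rem (gcdn i N)) ?mem_index_iota //= eqxx !mul1r.
      rewrite big_seq big1 ?addr0 // => d.
      rewrite mem_rem_uniq ?iota_uniq // inE eq_sym => /andP[/negPf-> _].
      by rewrite mul0r.
    rewrite mul0r mulr0 big_seq big1 // => d; rewrite mem_index_iota => dx'.
    by case: eqP dx dx' => [->|]; rewrite ?mul0r // ltnS => /negP.
  rewrite exchange_big /=; apply: eq_big_nat => d; rewrite ltnS => dx.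
  have d0 : d%:R != 0 :> R by rewrite pnatr_eq0; lia.
  rewrite -mulr_suml -/(c d); have := c0 _ (xN _ dx).
  by move=> /gt_eqF/negbT cd0; field; rewrite d0.
have hN d e : (d %| e)%N -> (e %| N)%N -> - h d <= - h e.
  move=> de eN; have e0 : (0 < e)%N by apply: dvdn_gt0 eN.
  have d0 : (0 < d)%N by apply: dvdn_gt0 de.
  have dN := dvdn_trans de eN; rewrite lerN2 /h e0 d0 /=.
  have [ex|ex] := leqP e x; last first.
    by rewrite mul0r mulr_ge0 ?invr_ge0 ?mulr_ge0 ?ler0n // ltW ?c0.
  rewrite (leq_trans (dvdn_leq e0 de) ex) -[true%:R]/(1 : R) !mul1r lef_pV2 ?c_mono //;
    by rewrite posrE mulr_gt0 ?ltr0n ?c0.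
have fN : div_monotone N (fun d => - (nodiv s d)%:R : R).
  move=> d e de eN; rewrite lerN2 ler_nat.
  by case E: (nodiv s e) => //; rewrite (nodiv_dvd de E).
have := harris N0 fN hN.
rewrite !sumrN mulrNN; under [in leRHS]eq_bigr do rewrite mulrNN.
have /= -> := sum_h (fun d => (nodiv s d)%:R).
have -> : \sum_(i < N) h (gcdn i N) = \sum_(1 <= k < x.+1) k%:R^-1.
  under [RHS]eq_bigr do rewrite -div1r.
  by rewrite -(sum_h (fun=> 1)); apply: eq_bigr => i _; rewrite mul1r.
under eq_bigr do rewrite nodiv_gcd //.
by rewrite sum_nodiv // -mulrA ler_pM2l ?ltr0n // mulrC.
Qed.

(** Freeness from [s1] and freeness from [s2] both decrease along divisibility of [gcd(i, N)], so
    Harris' inequality makes them nonnegatively correlated. *)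
Lemma behrend s1 s2 : (forall a, a \in s1 -> 0 < a)%N ->
  (forall a, a \in s2 -> 0 < a)%N ->
  free_density s1 * free_density s2 <= free_density (s1 ++ s2).
Proof.
move=> s10 s20; have s0 a : a \in s1 ++ s2 -> (0 < a)%N.
  by rewrite mem_cat => /orP[/s10|/s20].
pose N := (\prod_(a <- s1 ++ s2) a)%N.
have N0 : (0 < N)%N by apply: prod_seq_gt0.
have sN a : a \in s1 ++ s2 -> (a %| N)%N by apply: dvdn_prod_mem.
have sN1 a : a \in s1 -> (a %| N)%N by move=> sa; rewrite sN // mem_cat sa.
have sN2 a : a \in s2 -> (a %| N)%N by move=> sa; rewrite sN // mem_cat sa orbT.
have mono s : div_monotone N (fun d => - (nodiv s d)%:R : R).
  move=> d e de eN; rewrite lerN2 ler_nat.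
  by case E: (nodiv s e) => //; rewrite (nodiv_dvd de E).
have := harris N0 (mono s1) (mono s2); rewrite !sumrN mulrNN.
under eq_bigr do rewrite nodiv_gcd //.
under [X in _ * X <= _]eq_bigr do rewrite nodiv_gcd //.
under [X in _ <= _ * X]eq_bigr => i _.
  rewrite !nodiv_gcd // mulrNN -natrM mulnb -all_cat -/(nodiv (s1 ++ s2) i).
  over.
rewrite !sum_nodiv // mulrACA -mulrA ler_pM2l ?ltr0n // ler_pM2l ?ltr0n //.
Qed.

(** The residue modulo [L] decides [nodiv s] and is independent of the residue modulo [m]. *)
Lemma sum_nodiv_progression s (m L r : nat) : (0 < m)%N -> (0 < L)%N ->
  coprime m L -> (forall a, a \in s -> a %| L)%N ->
  \sum_(i < m * L) ((i == r %[mod m]) && nodiv s i)%:R =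
  \sum_(j < L) (nodiv s j)%:R :> R.
Proof.
move=> m0 L0 co_mL sL.
transitivity (\sum_(k < m * L)
    ((k %% m == r %% m)%N && nodiv s (k %% L)%N)%:R : R).
  apply: eq_bigr => k _; rewrite -(nodiv_gcd _ sL) -gcdn_modl nodiv_gcd //.
rewrite (crt_sum (fun i j => ((i == r %% m)%N && nodiv s j)%:R)) //.
have rm := ltn_pmod r m0.
rewrite (bigD1 (Ordinal rm)) //= eqxx [X in _ + X]big1 ?addr0 // => i.
by rewrite -(inj_eq val_inj) /= => /negPf ->; rewrite big1.
Qed.

End FreeDensity.

(** * Logarithmic density of sets of multiples *)

Section LogAverage.
Variable R : realType.
Implicit Types f g : nat -> R.

Definition log_sum f (n : nat) : R := \sum_(1 <= k < n.+1) f k / k%:R.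

Definition log_average f (n : nat) : R := (ln n%:R)^-1 * log_sum f n.

Lemma log_sumS f n : log_sum f n.+1 = log_sum f n + f n.+1 / n.+1%:R.
Proof. by rewrite /log_sum big_nat_recr. Qed.

Lemma le_log_sum f g n : (forall k, (0 < k)%N -> f k <= g k) ->
  log_sum f n <= log_sum g n.
Proof.
move=> fg; rewrite /log_sum big_nat_cond [leRHS]big_nat_cond.
apply: ler_sum => k /andP[/andP[k0 _] _].
by rewrite ler_wpM2r ?invr_ge0 ?ler0n // fg.
Qed.

Lemma inv_ln_ge0 (n : nat) : 0 <= (ln n%:R : R)^-1.
Proof.
rewrite invr_ge0; case: n => [|n]; first by rewrite ln0.
by rewrite ln_ge0 // ler1n.
Qed.

Lemma le_log_average f g n : (forall k, (0 < k)%N -> f k <= g k) ->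
  log_average f n <= log_average g n.
Proof. by move=> fg; rewrite ler_wpM2l ?inv_ln_ge0 ?le_log_sum. Qed.

Lemma log_averageD f g n :
  log_average (fun k => f k + g k) n = log_average f n + log_average g n.
Proof.
rewrite /log_average -mulrDr /log_sum -big_split; congr (_ * _).
by apply: eq_bigr => k _; rewrite mulrDl.
Qed.

Lemma cvg_inv_ln : (ln (n%:R : R))^-1 @[n --> \oo] --> (0 : R).
Proof.
apply/cvgrPdist_lt => e e0; near=> n.
have n1 : 1 < n%:R :> R by rewrite ltr1n; near: n; exact: nbhs_infty_gt.
have ln0 : 0 < ln (n%:R : R) by rewrite ln_gt0.
rewrite sub0r normrN gtr0_norm ?invr_gt0 // invf_plt ?posrE //.
rewrite -[e^-1]expRK ltr_ln ?posrE ?expR_gt0 ?(lt_trans ltr01) //.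
near: n; exact: nbhs_infty_gtr.
Unshelve. all: by end_near. Qed.

(** Telescopes [ln (1 + 1/(n+1)) <= 1/(n+1)]. *)
Lemma ln_le_harmonic n : ln (n.+1%:R : R) <= log_sum (fun=> 1) n.
Proof.
elim: n => [|n IH]; first by rewrite ln1 /log_sum big_geq.
have n1 : 0 < n.+1%:R :> R by rewrite ltr0n.
have n2 : 0 < n.+2%:R :> R by rewrite ltr0n.
rewrite log_sumS -(subrK (ln n.+1%:R) (ln n.+2%:R)) addrC lerD //.
rewrite -ln_div ?posrE // div1r.
have -> : n.+2%:R / n.+1%:R = 1 + n.+1%:R^-1 :> R.
  by rewrite -[n.+2]add1n natrD mulrDl mulfV ?gt_eqF // mul1r addrC.
by rewrite le_ln1Dx // (lt_trans (ltrN10 R)) // invr_gt0.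
Qed.

(** Telescopes [ln (1 - 1/(n+2)) <= - 1/(n+2)]. *)
Lemma harmonic_le_ln n : log_sum (fun=> 1) n.+1 <= 1 + ln (n.+1%:R : R).
Proof.
elim: n => [|n IH].
  by rewrite log_sumS /log_sum big_geq // ln1 divr1 add0r addr0.
have n1 : 0 < n.+1%:R :> R by rewrite ltr0n.
have n2 : 0 < n.+2%:R :> R by rewrite ltr0n.
rewrite log_sumS -(subrK (ln n.+1%:R) (ln n.+2%:R)) addrCA addrC.
rewrite lerD // -lerN2 opprB -ln_div ?posrE // div1r.
have -> : n.+1%:R / n.+2%:R = 1 + - n.+2%:R^-1 :> R.
  by rewrite -[in LHS](addnK 1%N n.+1) addn1 natrB // mulrBl mulfV ?gt_eqF // mul1r.
by rewrite le_ln1Dx // ltrN2 invf_lt1 // ltr1n.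
Qed.

Lemma cvg_log_average_bounded (C : R) f :
  (forall n, `|log_sum f n| <= C) -> log_average f n @[n --> \oo] --> (0 : R).
Proof.
move=> fC; apply: (@squeeze_cvgr _ _ _ _ (fun n => - ((ln n%:R)^-1 * C))
    (fun n => (ln n%:R)^-1 * C)).
- near=> n; rewrite -ler_norml normrM (ger0_norm (inv_ln_ge0 n)).
  by rewrite ler_wpM2l ?inv_ln_ge0.
- rewrite -oppr0 -(mul0r C); apply: cvgN; apply: cvgMl; exact: cvg_inv_ln.
- rewrite -(mul0r C); apply: cvgMl; exact: cvg_inv_ln.
Unshelve. all: by end_near. Qed.

Lemma cvg_log_average1 : log_average (fun=> 1) n @[n --> \oo] --> (1 : R).
Proof.
apply: (@squeeze_cvgr _ _ _ _ (fun=> 1) (fun n => 1 + (ln n%:R)^-1));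
  last 2 first.
- exact: cvg_cst.
- rewrite -[X in _ --> X]addr0; apply: cvgD; [exact: cvg_cst|exact: cvg_inv_ln].
have bnd n : (1 < n)%N ->
    1 <= log_average (fun=> 1) n <= 1 + (ln (n%:R : R))^-1.
  move=> n1; have ln0 : 0 < ln (n%:R : R) by rewrite ln_gt0 // ltr1n.
  rewrite /log_average -(ler_pM2l ln0) -[X in _ && X](ler_pM2l ln0).
  rewrite mulVKf ?gt_eqF // mulrDr mulfV ?gt_eqF // mulr1 [X in _ && (_ <= X)]addrC.
  case: n n1 {ln0} => // n n1.
  rewrite harmonic_le_ln andbT (le_trans _ (ln_le_harmonic _)) //.
  by rewrite ler_ln ?posrE ?ltr0n // ler_nat.
by near=> n; apply: bnd; near: n; exact: nbhs_infty_gt.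
Unshelve. all: by end_near. Qed.

(** Complete periods cancel, so only an initial piece of one period remains. *)
Lemma periodic_sum_bounded (L : nat) f : (0 < L)%N ->
  (forall i, f (i + L)%N = f i) -> \sum_(i < L) f i = 0 ->
  forall m, `|\sum_(i < m) f i| <= \sum_(i < L) `|f i|.
Proof.
move=> L0 fL fs m; rewrite (divn_eq m L) big_split_ord /=.
rewrite (sum_periodic _ fL) fs mul0rn add0r.
have fkL k i : f (k * L + i)%N = f i.
  by elim: k => [|k IH]; rewrite ?mul0n // mulSn -addnA addnC fL.
under eq_bigr do rewrite fkL.
apply: (le_trans (ler_norm_sum _ _ _)).
have mL : (m %% L <= L)%N by rewrite ltnW // ltn_pmod.
rewrite (big_ord_widen _ (fun i => `|f i|) mL).
by rewrite [leRHS](bigID (fun i : 'I_L => (i < m %% L)%N)) lerDl sumr_ge0.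
Qed.

(* Summation by parts. *)
Lemma log_sum_bounded (C : R) f : (forall m, `|\sum_(i < m) f i| <= C) ->
  forall n, `|log_sum f n| <= 3 * C.
Proof.
move=> fC n; pose F m := \sum_(i < m) f i.
have C0 : 0 <= C by apply: le_trans (fC 0%N); rewrite normr_ge0.
have FS m : f m = F m.+1 - F m by rewrite /F big_ord_recr /= [X in X - _]addrC addrK.
(* Once the boundary term is removed, each step costs [C] times a difference of consecutive
   reciprocals, and these telescope. *)
have T k : `|log_sum f k - F k.+1 / k.+1%:R| <= C * (2 - k.+1%:R^-1).
  elim: k => [|k IH].
    rewrite /log_sum big_geq // divr1 sub0r normrN invr1.
    by apply: le_trans (fC 1%N) _; lra.
  have k1 : k.+1%:R != 0 :> R by rewrite pnatr_eq0.
  have k2 : k.+2%:R != 0 :> R by rewrite pnatr_eq0.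
  have -> : log_sum f k.+1 - F k.+2 / k.+2%:R = (log_sum f k - F k.+1 / k.+1%:R)
      + F k.+2 * (k.+1%:R^-1 - k.+2%:R^-1).
    rewrite log_sumS FS; move: (k.+1%:R : R) (k.+2%:R : R) k1 k2 => a b a0 b0.
    by field; rewrite a0 b0.
  apply: (le_trans (ler_normD _ _)).
  have -> : C * (2 - k.+2%:R^-1) = C * (2 - k.+1%:R^-1) +
      C * (k.+1%:R^-1 - k.+2%:R^-1) by ring.
  rewrite lerD // normrM ler_pM ?normr_ge0 // ?fC //.
  by rewrite ger0_norm // subr_ge0 lef_pV2 ?posrE ?ltr0n // ler_nat.
rewrite -(subrK (F n.+1 / n.+1%:R) (log_sum f n)).
apply: (le_trans (ler_normD _ _)).
have -> : 3 * C = C * 2 + C by ring.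
rewrite lerD // ?(le_trans (T n)) //.
  by rewrite ler_wpM2l // gerBl invr_ge0 ler0n.
rewrite normrM -[leRHS]mulr1 ler_pM ?normr_ge0 ?fC //.
by rewrite ger0_norm ?invr_ge0 ?ler0n // invf_le1 ?ltr0n // ler1n.
Qed.

(** After subtraction of the mean [c] the partial sums are bounded; so is the logarithmic sum, which
    then vanishes against [ln n]. *)
Lemma cvg_log_average_periodic (L : nat) f : (0 < L)%N ->
  (forall i, f (i + L)%N = f i) ->
  log_average f n @[n --> \oo] --> (\sum_(i < L) f i) / L%:R.
Proof.
move=> L0 fL; set c := _ / _.
have LR0 : L%:R != 0 :> R by rewrite pnatr_eq0 -lt0n.
pose g i := f i - c.
have gL i : g (i + L)%N = g i by rewrite /g fL.
have g0 : \sum_(i < L) g i = 0.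
  by rewrite sumrB sumr_const card_ord -mulr_natr divfK // subrr.
have /cvg_log_average_bounded g_cvg :=
  log_sum_bounded (periodic_sum_bounded L0 gL g0).
have -> : log_average f = fun n => log_average g n + c * log_average (fun=> 1) n.
  apply/funext => n; rewrite -[in RHS]mulrCA /log_average -mulrDr; congr (_ * _).
  rewrite /log_sum mulr_sumr -big_split; apply: eq_bigr => k _ /=.
  by rewrite /g; ring.
rewrite -[X in _ --> X]add0r -[X in _ --> (_ + X)]mulr1.
by apply: cvgD => //; apply: cvgMr; exact: cvg_log_average1.
Qed.

(** With [k = e * j], the weight [1 / (e * j)] is at most [1 / j], and [j] runs only up to
    [n / e]. *)
Lemma log_sum_dilate (e : nat) f n : (0 < e)%N -> (forall k, 0 <= f k) ->
  log_sum (fun k => (e %| k)%:R * f (k %/ e)%N) n <= log_sum f n.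
Proof.
move=> e0 f0; apply: (@le_trans _ _ (log_sum f (n %/ e)%N)).
  elim: n => [|n IH]; first by rewrite div0n /log_sum !big_geq.
  rewrite log_sumS divnS //; case: (boolP (e %| n.+1)%N) => [en|_]; last first.
    by rewrite mul0r mul0r addr0 add0n.
  rewrite add1n log_sumS lerD // mul1r.
  rewrite ler_wpM2l // lef_pV2 ?posrE ?ltr0n // ler_nat ltnS.
  exact: leq_div.
have : (n %/ e <= n)%N by apply: leq_div.
move: (n %/ e)%N => k kn; rewrite /log_sum [leRHS](@big_cat_nat _ _ _ k.+1) //=.
by rewrite lerDl sumr_ge0 // => i _; rewrite mulr_ge0 // invr_ge0.
Qed.

End LogAverage.

(** * The Davenport-Erdos theorem and the density of the free numbers *)

Section Multiples.
Variable R : realType.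
Implicit Types (A B C : set nat) (s : seq nat).

Definition hit B (k : nat) : bool := k%:Z \in multiples B.

Lemma hitP B k : reflect (exists2 b, B b & (b %| k)%N) (hit B k).
Proof. by apply: (iffP idP); rewrite /hit inE. Qed.

Lemma log_densityE B : log_density R (multiples B) =
  limn (log_average (fun k => (hit B k)%:R : R)).
Proof.
rewrite /log_density.
have -> // : (fun n : nat => (ln n%:R)^-1 *
      \sum_(1 <= k < n.+1 | k%:Z \in multiples B) (k%:R : R)^-1) =
    log_average (fun k => (hit B k)%:R : R).
apply/funext => n; rewrite /log_average /log_sum big_mkcond; congr (_ * _).
by apply: eq_bigr => k _; rewrite -/(hit B k); case: hit; rewrite ?mul1r ?mul0r.
Qed.

(** By Davenport-Erdos this is one minus the logarithmic density of the multiples of [B]; it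
    replaces limits by finite counts. *)
Definition free_inf B : R :=
  inf [set free_density R s | s in [set s : seq nat | forall a, a \in s -> B a]].

Lemma free_inf_has_inf B :
  has_inf [set free_density R s | s in [set s : seq nat | forall a, a \in s -> B a]].
Proof.
split; first by exists (free_density R [::]), [::].
by exists 0 => _ [s _ <-]; rewrite free_density_ge0.
Qed.

Lemma free_inf_le B s : (forall a, a \in s -> B a) ->
  free_inf B <= free_density R s.
Proof.
by move=> sB; apply: ge_inf; [case: (free_inf_has_inf B)|exists s].
Qed.

Lemma free_inf_ge B (x : R) :
  (forall s, (forall a, a \in s -> B a) -> x <= free_density R s) ->
  x <= free_inf B.
Proof.
move=> xs; apply: lb_le_inf; first by case: (free_inf_has_inf B).
by move=> _ [s sB <-]; apply: xs.
Qed.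

Lemma free_inf_adherent B (e : R) : 0 < e ->
  exists2 s, (forall a, a \in s -> B a) & free_density R s < free_inf B + e.
Proof.
move=> e0; have [_ [s sB <-] se] := inf_adherent e0 (free_inf_has_inf B).
by exists s.
Qed.

Lemma free_inf_ge0 B : 0 <= free_inf B.
Proof. by apply: free_inf_ge => s _; apply: free_density_ge0. Qed.

Lemma nodiv_hit s B k : (forall a, a \in s -> B a) ->
  ((~~ nodiv s k)%:R : R) <= (hit B k)%:R.
Proof.
move=> sB; rewrite ler_nat; case: hitP => [_|nB]; first by rewrite leq_b1.
by case: nodivP => // -[] a /sB Ba; apply/negP => ak; apply: nB; exists a.
Qed.

Lemma cvg_log_average_nodiv s : (forall a, a \in s -> (0 < a)%N) ->
  log_average (fun k => (nodiv s k)%:R) n @[n --> \oo] --> free_density R s.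
Proof.
move=> s0; apply: cvg_log_average_periodic; first exact: prod_seq_gt0.
by move=> i; rewrite nodivD // => a; apply: dvdn_prod_mem.
Qed.

(* Davenport-Erdos: only the elements of [B] up to [n] matter for
   [log_sum _ n], and they are controlled uniformly by [log_sum_nodiv]. *)
Lemma cvg_log_average_hit B : (forall b, B b -> (0 < b)%N) ->
  log_average (fun k => (hit B k)%:R) n @[n --> \oo] --> 1 - free_inf B.
Proof.
move=> B0.
have upper n : log_average (fun k => (hit B k)%:R) n <=
    log_average (fun=> 1) n * (1 - free_inf B).
  rewrite -mulrA ler_wpM2l ?inv_ln_ge0 //.
  pose s := [seq a <- iota 1 n | `[< B a >]].
  have sB a : a \in s -> B a by rewrite mem_filter => /andP[/asboolP].
  have s0 a : a \in s -> (0 < a)%N by move/sB/B0.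
  have -> : log_sum (fun k => (hit B k)%:R) n =
      log_sum (fun=> 1) n - log_sum (fun k => (nodiv s k)%:R : R) n.
    rewrite /log_sum -sumrB; apply: eq_big_nat => k /andP[k0]; rewrite ltnS => kn.
    rewrite -mulrBl; congr (_ / _).
    case: nodivP => [nk|nk].
      rewrite subrr; case: hitP => // -[b Bb bk].
      suff /nk : b \in s by rewrite bk.
      rewrite mem_filter; apply/andP; split; first exact/asboolP.
      by rewrite mem_iota B0 //= add1n ltnS (leq_trans (dvdn_leq k0 bk)).
    rewrite subr0; case: hitP => // nB; exfalso; apply: nk => a /sB Ba.
    by apply/negP => ak; apply: nB; exists a.
  have := log_sum_nodiv R n s0.
  have := free_inf_le sB; have := ln_le_harmonic R n.
  have : 0 <= ln (n.+1%:R : R) by rewrite ln_ge0 // ler1n.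
  have -> : \sum_(1 <= k < n.+1) k%:R^-1 = log_sum (fun=> 1 : R) n.
    by apply: eq_bigr => k _; rewrite div1r.
  rewrite -/(log_sum (fun k => (nodiv s k)%:R) n).
  move: (log_sum _ n) (free_density R s) => x y /le_trans H /H x0 ty xy.
  have := ler_wpM2l x0 ty; lra.
apply/cvgrPdist_lt => e e0.
have e2 : 0 < e / 2 by rewrite divr_gt0.
have [s sB st] := free_inf_adherent B e2.
have s0 a : a \in s -> (0 < a)%N by move/sB/B0.
(* Multiples of elements of [s] are hits of [B], and the free density of [s] exceeds [free_inf B] by
   less than [e / 2]. *)
have lower n : log_average (fun=> 1) n - log_average (fun k => (nodiv s k)%:R) n
    <= log_average (fun k => (hit B k)%:R) n :> R.
  rewrite lerBlDr -log_averageD; apply: le_log_average => k _ /=.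
  case: (nodiv s k) (nodiv_hit k sB) => ?; last by rewrite addr0.
  by rewrite lerDr ler0n.
have up_cvg : log_average (fun=> 1) n * (1 - free_inf B) @[n --> \oo]
    --> 1 - free_inf B.
  by rewrite -[X in _ --> X]mul1r; apply: cvgMl; exact: cvg_log_average1.
have low_cvg : log_average (fun=> 1) n - log_average (fun k => (nodiv s k)%:R) n
    @[n --> \oo] --> 1 - free_density R s.
  by apply: cvgB; [exact: cvg_log_average1|exact: cvg_log_average_nodiv].
have /cvgrPdist_lt/(_ _ e0) up_near := up_cvg.
have /cvgrPdist_lt/(_ _ e2) low_near := low_cvg.
near=> n.
have un := upper n; have ln := lower n.
have u : `|1 - free_inf B - log_average (fun=> 1) n * (1 - free_inf B)| < e.
  by near: n.
have l : `|1 - free_density R s - (log_average (fun=> 1) n -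
    log_average (fun k => (nodiv s k)%:R) n)| < e / 2.
  by near: n.
move: u l; rewrite !ltr_norml => /andP[u1 u2] /andP[l1 l2].
by apply/andP; split; lra.
Unshelve. all: by end_near. Qed.

Lemma log_density_multiples B : (forall b, B b -> (0 < b)%N) ->
  log_density R (multiples B) = 1 - free_inf B.
Proof.
move=> B0; rewrite log_densityE; apply: cvg_lim => //.
exact: cvg_log_average_hit.
Qed.

Lemma tautP B : (forall b, B b -> (0 < b)%N) ->
  taut R B <-> forall b, B b -> free_inf B < free_inf (B `\ b).
Proof.
move=> B0; have B'0 b a : (B `\ b) a -> (0 < a)%N by case=> /B0.
split=> H b /H; rewrite !log_density_multiples //; move: (B'0 b);
  by rewrite ?ltrD2l ?ltrN2.
Qed.

(** Behrend's inequality for the [A]-part and the [B]-part of a finite list, passed to the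
    infimum. *)
Lemma free_infU A B : (forall b, A b -> (0 < b)%N) -> (forall b, B b -> (0 < b)%N) ->
  free_inf A * free_inf B <= free_inf (A `|` B).
Proof.
move=> A0 B0; apply: free_inf_ge => s sAB.
pose s1 := [seq a <- s | `[< A a >]]; pose s2 := [seq a <- s | `[< B a >]].
have s1A a : a \in s1 -> A a by rewrite mem_filter => /andP[/asboolP].
have s2B a : a \in s2 -> B a by rewrite mem_filter => /andP[/asboolP].
have s10 a : a \in s1 -> (0 < a)%N by move/s1A/A0.
have s20 a : a \in s2 -> (0 < a)%N by move/s2B/B0.
apply: le_trans (le_trans _ (behrend R s10 s20)) _.
  exact: ler_pM (free_inf_ge0 _) (free_inf_ge0 _) (free_inf_le s1A) (free_inf_le s2B).
apply: free_density_subset => a.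
  by rewrite mem_cat => /orP[/s10|/s20].
move=> sa; rewrite mem_cat !mem_filter sa !andbT.
by case: (sAB a sa) => [/asboolP->//|/asboolP->]; rewrite orbT.
Qed.

Lemma free_inf0 : free_inf set0 = 1.
Proof.
apply/le_anti/andP; split.
  have /free_inf_le : forall a, a \in [::] -> @set0 nat a by [].
  by rewrite /free_density !big_nil big_ord_recl big_ord0 addr0 divr1.
apply: free_inf_ge => -[|a s] sB; last by case: (sB a); rewrite mem_head.
by rewrite /free_density !big_nil big_ord_recl big_ord0 addr0 divr1.
Qed.

(** Serves in the contrapositive: if a finite union has [free_inf] zero, so does one of its
    members. *)
Lemma free_inf_bigcup (I : eqType) (r : seq I) (C : I -> set nat) :
  (forall i c, C i c -> (0 < c)%N) -> (forall i, i \in r -> 0 < free_inf (C i)) ->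
  0 < free_inf [set c | exists2 i, i \in r & C i c].
Proof.
move=> C0; elim: r => [|i r IH] Cr.
  have -> : [set c | exists2 i, i \in [::] & C i c] = set0.
    by apply/seteqP; split=> // c [].
  by rewrite free_inf0.
have -> : [set c | exists2 j, j \in i :: r & C j c] =
    C i `|` [set c | exists2 j, j \in r & C j c].
  apply/seteqP; split=> c.
    by move=> [j]; rewrite inE => /orP[/eqP->|jr] Cc; [left|right; exists j].
  by case=> [Cc|[j jr Cc]]; [exists i|exists j]; rewrite ?mem_head // inE jr orbT.
apply: lt_le_trans (free_infU _ _); last 2 first.
- exact: C0.
- by move=> c [j _ /C0].
apply: mulr_gt0; first by rewrite Cr ?mem_head.
by apply: IH => j jr; rewrite Cr // inE jr orbT.
Qed.

End Multiples.

(** * Tautness *)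

Section Tautness.
Variable R : realType.
Implicit Types (B C : set nat) (s : seq nat).

Lemma le_limit_log_average f g (x y : R) :
  (forall k, (0 < k)%N -> f k <= g k) ->
  log_average f n @[n --> \oo] --> x -> log_average g n @[n --> \oo] --> y ->
  x <= y.
Proof.
move=> fg fx gy; apply: (ler_cvg_to fx gy); apply: nearW => n.
exact: le_log_average.
Qed.

Lemma sum_progression (m r : nat) : (0 < m)%N ->
  \sum_(i < m) (i == r %[mod m])%:R = 1 :> R.
Proof.
move=> m0; rewrite (bigD1 (Ordinal (ltn_pmod r m0))) //= modn_mod eqxx.
rewrite big1 ?addr0 // => i; rewrite -(inj_eq val_inj) /=.
by rewrite [(i %% m)%N]modn_small // => /negPf ->.
Qed.

(** With [m] the product of [s], any [k] congruent to [b] modulo [b * m] is a multiple of [b] with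
    [k / b] congruent to 1 modulo [m]. No [a] in [s] divides [k / b], so no other element of [B]
    divides [k]: removing [b] loses density at least [1 / (b * m)]. *)
Lemma free_inf_setD1 B b s : (forall b, B b -> (0 < b)%N) -> B b ->
  (forall a, a \in s -> (1 < a)%N) ->
  (forall b', B b' -> b' != b -> exists2 a, a \in s & (a %| b' %/ gcdn b' b)%N) ->
  free_inf R B < free_inf R (B `\ b).
Proof.
move=> B0 Bb s1 sB; have b0 := B0 _ Bb.
pose m := (\prod_(a <- s) a)%N.
have m0 : (0 < m)%N by apply: prod_seq_gt0 => a /s1 /ltnW.
have bm0 : (0 < b * m)%N by rewrite muln_gt0 b0.
have B'0 a : (B `\ b) a -> (0 < a)%N by case=> /B0.
have ap : log_average (fun k => (k == b %[mod b * m])%:R : R) n @[n --> \oo]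
    --> ((b * m)%:R^-1 : R).
  have perI i : ((i + b * m == b %[mod b * m])%:R : R) = (i == b %[mod b * m])%:R.
    by rewrite modnDr.
  by have := cvg_log_average_periodic bm0 perI; rewrite sum_progression // mul1r.
have le_hit : 1 - free_inf R (B `\ b) + (b * m)%:R^-1 <= 1 - free_inf R B.
  apply: (@le_limit_log_average (fun k => (hit (B `\ b) k)%:R +
      (k == b %[mod b * m])%:R) (fun k => (hit B k)%:R)).
  - move=> k _; rewrite -natrD ler_nat.
    have [/eqP kb|_] := boolP (k == b %[mod b * m]); last first.
      rewrite addn0; case: hitP => // -[b' [Bb' _] b'k].
      by case: hitP => // -[]; exists b'.
    have bk : (b %| k)%N.
      by rewrite /dvdn -(modn_dvdm k (dvdn_mulr m (dvdnn b))) kb modn_dvdm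
        ?dvdn_mulr // modnn.
    have kE : k = (b * (k %/ b))%N by rewrite mulnC divnK.
    have q1 : k %/ b = 1 %[mod m].
      by apply/eqP; rewrite -(eqn_pmul2l b0) !muln_modr -kE muln1 kb.
    rewrite (_ : hit B k); last by apply/hitP; exists b.
    case: hitP => // -[b' [Bb' /eqP b'b] b'k].
    have [a sa ab] := sB b' Bb' b'b.
    pose g := gcdn b' b; have g0 : (0 < g)%N by rewrite gcdn_gt0 b0 orbT.
    (* As [b'] divides [b * (k / b)] and [b' / g] is coprime to [b / g], the number [b' / g] divides
       [k / b]. *)
    have aq : (a %| k %/ b)%N.
      apply: dvdn_trans ab _; rewrite -(@Gauss_dvdr _ (b %/ g)); last first.
        rewrite /coprime -(eqn_pmul2l g0) muln_gcdr muln1.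
        by rewrite ![(g * _)%N]mulnC !divnK ?dvdn_gcdl ?dvdn_gcdr.
      rewrite -(dvdn_pmul2l g0) mulnA ![(g * _)%N]mulnC.
      by rewrite !divnK ?dvdn_gcdl ?dvdn_gcdr // -kE.
    have am : (a %| m)%N by exact: dvdn_prod_mem.
    have : (a %| 1)%N by rewrite /dvdn -(modn_dvdm 1 am) -q1 modn_dvdm.
    by rewrite dvdn1 => /eqP a1; have := s1 a sa; rewrite a1.
  - have -> : log_average (fun k => (hit (B `\ b) k)%:R +
      (k == b %[mod b * m])%:R : R) = fun n =>
      log_average (fun k => (hit (B `\ b) k)%:R) n +
      log_average (fun k => (k == b %[mod b * m])%:R) n.
      by apply/funext => n; rewrite log_averageD.
    by apply: cvgD => //; exact: cvg_log_average_hit.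
  - exact: cvg_log_average_hit.
have : 0 < (b * m)%:R^-1 :> R by rewrite invr_gt0 ltr0n.
lra.
Qed.

(** For a finite part [s] of [C], the [s]-free numbers in the class of [r] have density
    [free_density s / m] by independence, and all are hits of [C] missed by [s]. Letting [s]
    approach the infimum contradicts [free_inf C > 0]. *)
Lemma free_inf_progression C m r : (forall c, C c -> (0 < c)%N) -> (0 < m)%N ->
  (forall c, C c -> coprime m c) -> (forall k, k = r %[mod m] -> hit C k) ->
  free_inf R C = 0.
Proof.
move=> C0 m0 Cm Cr.
have key s : (forall c, c \in s -> C c) ->
    free_inf R C / m%:R <= free_density R s - free_inf R C.
  move=> sC; pose L := (\prod_(a <- s) a)%N.
  have s0 a : a \in s -> (0 < a)%N by move/sC/C0.
  have L0 : (0 < L)%N by exact: prod_seq_gt0.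
  have mR0 : m%:R != 0 :> R by rewrite pnatr_eq0 -lt0n.
  have mL : coprime m L.
    rewrite /L big_seq; elim/big_ind: _ => [|x y|a /sC/Cm //].
      exact: coprimen1.
    by rewrite coprimeMr => -> ->.
  have sL a : a \in s -> (a %| L)%N by exact: dvdn_prod_mem.
  have ap : log_average (fun k => ((k == r %[mod m]) && nodiv s k)%:R : R) n
      @[n --> \oo] --> free_density R s / m%:R.
    have -> : free_density R s / m%:R =
        (\sum_(i < m * L) ((i == r %[mod m]) && nodiv s i)%:R) / (m * L)%:R.
      rewrite sum_nodiv_progression // /free_density -/L natrM invfM mulrAC.
      by rewrite mulrA mulrAC.
    apply: cvg_log_average_periodic; first by rewrite muln_gt0 m0.
    move=> i; rewrite nodivD; last by move=> a sa; rewrite dvdn_mull ?sL.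
    by rewrite addnC mulnC modnMDl.
  apply: (@le_trans _ _ (free_density R s / m%:R)).
    by rewrite ler_wpM2r ?invr_ge0 ?ler0n // free_inf_le.
  suff : free_density R s / m%:R + (1 - free_density R s) <= 1 - free_inf R C.
    lra.
  apply: (@le_limit_log_average (fun k => ((k == r %[mod m]) && nodiv s k)%:R +
      (1 - (nodiv s k)%:R)) (fun k => (hit C k)%:R)).
  - move=> k _; have := nodiv_hit R k sC; case: (nodiv s k) => /= H.
      rewrite subrr addr0 andbT ler_nat; case: eqP => // kr.
      by rewrite Cr.
    by rewrite andbF subr0 add0r.
  - have -> : log_average (fun k => ((k == r %[mod m]) && nodiv s k)%:R +
      (1 - (nodiv s k)%:R) : R) = fun n =>
      log_average (fun k => ((k == r %[mod m]) && nodiv s k)%:R) n +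
      (log_average (fun=> 1) n - log_average (fun k => (nodiv s k)%:R) n).
      apply/funext => n; rewrite log_averageD; congr (_ + _).
      apply/eqP; rewrite eq_sym subr_eq -log_averageD; apply/eqP.
      by congr (log_average _ _); apply/funext => k; rewrite subrK.
    apply: cvgD => //; apply: cvgB; first exact: cvg_log_average1.
    exact: cvg_log_average_nodiv.
  - exact: cvg_log_average_hit.
apply/le_anti; rewrite free_inf_ge0 andbT leNgt; apply/negP => C1.
have cm0 : 0 < free_inf R C / m%:R by rewrite divr_gt0 ?ltr0n.
have [s sC st] := free_inf_adherent C cm0.
have := key s sC; lra.
Qed.

(** By Behrend's inequality, [C] without one element [c] still has [free_inf] zero. Hence almost
    every multiple of [b = e * c] is a multiple of some other [e * c'], and removing [b] from [B]
    does not lower the density. *)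
Lemma not_taut_scaled B C e : (forall b, B b -> (0 < b)%N) ->
  (forall c, C c -> B (e * c)%N) -> (forall c, C c -> (1 < c)%N) ->
  free_inf R C = 0 -> ~ taut R B.
Proof.
move=> B0 CB C1 fC /tautP -/(_ B0) B_taut.
have [c Cc] : C !=set0.
  apply/set0P/negP => /eqP C0; move: fC; rewrite C0 free_inf0.
  by move/eqP; rewrite oner_eq0.
have C0 a : C a -> (0 < a)%N by move/C1/ltnW.
have C'0 a : (C `\ c) a -> (0 < a)%N by case=> /C0.
have Bb := CB c Cc; set b := (e * c)%N in Bb.
have B'0 a : (B `\ b) a -> (0 < a)%N by case=> /B0.
have e0 : (0 < e)%N by have := B0 _ Bb; rewrite muln_gt0 => /andP[].
have fC' : free_inf R (C `\ c) = 0.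
  have c1 a : a \in [:: c] -> (1 < a)%N by rewrite inE => /eqP ->; exact: C1.
  have fc := free_density_gt0 R c1.
  apply/le_anti; rewrite free_inf_ge0 andbT.
  rewrite -(ler_pM2r fc) mul0r -fC; apply: free_inf_ge => s sC.
  pose s' := [seq a <- s | a != c].
  have s'C a : a \in s' -> (C `\ c) a.
    by rewrite mem_filter => /andP[/eqP ac /sC Ca]; split.
  have s'0 a : a \in s' -> (0 < a)%N by move/s'C/C'0.
  have c0 a : a \in [:: c] -> (0 < a)%N by move/c1/ltnW.
  apply: le_trans (le_trans _ (behrend R s'0 c0)) _.
    by apply: ler_wpM2r; [exact: ltW|exact: free_inf_le].
  apply: free_density_subset => a.
    by rewrite mem_cat => /orP[/s'0|/c0].
  by move=> sa; rewrite mem_cat mem_filter sa andbT inE orNb.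
have := B_taut b Bb; rewrite ltNge => /negP[].
suff : 1 - free_inf R B <= 1 - free_inf R (B `\ b) + (1 - (1 - free_inf R (C `\ c))).
  by rewrite fC'; lra.
pose f k : R := 1 - (hit (C `\ c) k)%:R.
have f0 k : 0 <= f k by rewrite subr_ge0 lern1 leq_b1.
have le_avg n : log_average (fun k => (hit B k)%:R) n <=
    log_average (fun k => (hit (B `\ b) k)%:R) n +
    (log_average (fun=> 1) n - log_average (fun k => (hit (C `\ c) k)%:R : R) n).
  have -> : log_average (fun=> 1) n - log_average (fun k => (hit (C `\ c) k)%:R : R) n
      = log_average f n.
    apply/eqP; rewrite subr_eq -log_averageD; apply/eqP.
    by congr (log_average _ _); apply/funext => k; rewrite subrK.
  apply: (@le_trans _ _ (log_average (fun k => (hit (B `\ b) k)%:R) n +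
      log_average (fun k => (e %| k)%:R * f (k %/ e)%N) n)); last first.
    by rewrite lerD2l ler_wpM2l ?inv_ln_ge0 // log_sum_dilate.
  (* If only [b] divides [k] among the elements of [B], then [k / e] is free of [C] without [c]. *)
  rewrite -log_averageD; apply: le_log_average => k _.
  case: (hitP B) => [[b' Bb' b'k]|_]; last first.
    by rewrite addr_ge0 ?ler0n // mulr_ge0 ?ler0n.
  have [b'b|b'b] := eqVneq b' b; last first.
    have -> : hit (B `\ b) k by apply/hitP; exists b' => //; split => //; apply/eqP.
    by rewrite lerDl mulr_ge0 ?ler0n.
  have ek : (e %| k)%N by apply: dvdn_trans b'k; rewrite b'b dvdn_mulr.
  rewrite ek mul1r /f; case: (hitP (C `\ c)) => [[c' [Cc' c'c] c'k]|_].
    have -> : hit (B `\ b) k.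
      apply/hitP; exists (e * c')%N; last by rewrite mulnC -dvdn_divRL // c'k.
      split; first exact: CB.
      by rewrite /b => /eqP; rewrite eqn_pmul2l // => /eqP.
    by rewrite lerDl subr_ge0.
  by rewrite subr0 lerDr ler0n.
have cvg_r : log_average (fun k => (hit (B `\ b) k)%:R) n +
    (log_average (fun=> 1) n - log_average (fun k => (hit (C `\ c) k)%:R) n)
    @[n --> \oo] --> 1 - free_inf R (B `\ b) + (1 - (1 - free_inf R (C `\ c))).
  apply: cvgD; first exact: cvg_log_average_hit.
  by apply: cvgB; [exact: cvg_log_average1|exact: cvg_log_average_hit].
by apply: (ler_cvg_to (cvg_log_average_hit B0) cvg_r); exact: nearW.
Qed.

(** If the whole class were hit, dividing by [d = gcd(r, m)] gives a class modulo [m' = m / d] hit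
    by the numbers [b / gcd(b, d)] that are coprime to [m']. Their [free_inf] is zero, hence so is
    that of the part [C e] for one divisor [e] of [d], which contradicts tautness. *)
Lemma taut_progression B m r : (forall b, B b -> (0 < b)%N) -> taut R B ->
  (0 < m)%N -> (forall b, B b -> ~~ (b %| gcdn r m)%N) ->
  exists2 k, k = r %[mod m] & ~~ hit B k.
Proof.
move=> B0 B_taut m0 Bd; apply: contrapT => no.
have {}no k : k = r %[mod m] -> hit B k.
  by move=> km; apply/negPn/negP => nk; apply: no; exists k.
pose d := gcdn r m; have d0 : (0 < d)%N by rewrite gcdn_gt0 m0 orbT.
pose m' := (m %/ d)%N; pose r' := (r %/ d)%N.
have mE : m = (d * m')%N by rewrite mulnC divnK ?dvdn_gcdr.
have rE : r = (d * r')%N by rewrite mulnC divnK ?dvdn_gcdl.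
have m'0 : (0 < m')%N by move: m0; rewrite mE muln_gt0 => /andP[].
have co_rm : coprime r' m'.
  by rewrite /coprime -(eqn_pmul2l d0) muln_gcdr -mE -rE muln1.
pose C e : set nat := [set c | coprime m' c /\ B (e * c)%N].
pose D := [set c | exists2 e, e \in divisors d & C e c].
have C0 e c : C e c -> (0 < c)%N.
  by move=> [_ /B0]; rewrite muln_gt0 => /andP[].
have fD : free_inf R D = 0.
  apply: (@free_inf_progression D m' r') => //.
  - by move=> c [e _ /C0].
  - by move=> c [e _ []].
  move=> k kr.
  have /no/hitP[b Bb bk] : (d * k)%N = r %[mod m].
    by rewrite rE mE -!muln_modr kr.
  pose e := gcdn b d; pose c := (b %/ e)%N.
  have bE : b = (e * c)%N by rewrite mulnC divnK ?dvdn_gcdl.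
  have e0 : (0 < e)%N by rewrite gcdn_gt0 d0 orbT.
  have ck : (c %| k)%N.
    have : coprime c (d %/ e).
      rewrite /coprime -(eqn_pmul2l e0) muln_gcdr -bE muln1.
      by rewrite mulnC divnK ?dvdn_gcdr.
    move=> cd; rewrite -(Gauss_dvdr k cd) -(dvdn_pmul2l e0) -bE mulnA.
    by rewrite [(e * _)%N]mulnC divnK ?dvdn_gcdr.
  apply/hitP; exists c => //; exists e.
    by rewrite -dvdn_divisors // dvdn_gcdr.
  split; last by rewrite -bE.
  have co_km : coprime m' k.
    by rewrite -coprime_modr kr coprime_modr coprime_sym.
  exact: coprime_dvdr ck co_km.
have [e ed fe] : exists2 e, e \in divisors d & free_inf R (C e) = 0.
  apply: contrapT => noe.
  suff : 0 < free_inf R D by rewrite fD ltxx.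
  apply: free_inf_bigcup => // e ed.
  rewrite lt_def free_inf_ge0 andbT; apply/eqP => fe; apply: noe; by exists e.
apply: (@not_taut_scaled B (C e) e) => //.
  by move=> c [].
move=> c Cc; have c0 := C0 _ _ Cc; have [_ Bec] := Cc.
(* If [c = 1], then [e], a divisor of [gcd(r, m)], would belong to [B]. *)
rewrite ltn_neqAle c0 andbT; apply/negP => /eqP c1.
by move: Bec; rewrite -c1 muln1 => /Bd; rewrite -/d dvdn_divisors // ed.
Qed.

End Tautness.

(** * The group H and the window *)

Section DiscreteProduct.
Variables (I : choiceType) (K : I -> topologicalType).
Hypothesis K_discrete : forall i (x : K i) (A : set (K i)), nbhs x A <-> A x.

(** Cylinders over finite sets of coordinates form a filter that converges in every coordinate,
    hence in the product. It applies both to the residues and to the 0-1 sequences. *)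
Lemma nbhs_discrete_product (f : prod_topology K) (A : set (prod_topology K)) :
  nbhs f A <->
  exists s : seq I, forall g, (forall i, i \in s -> g i = f i) -> A g.
Proof.
split.
  pose F : set_system (prod_topology K) := [set A | exists s : seq I,
    forall g, (forall i, i \in s -> g i = f i) -> A g].
  have FF : Filter F.
    split.
    - by exists [::].
    - move=> P Q [s sP] [t tQ]; exists (s ++ t) => g gst; split.
        by apply: sP => i si; apply: gst; rewrite mem_cat si.
      by apply: tQ => i ti; apply: gst; rewrite mem_cat ti orbT.
    - by move=> P Q PQ [s sP]; exists s => g /sP /PQ.
  have Ff : F --> f.
    apply/cvg_sup => i U [V] [[W oW <-] WfN WU].
    by exists [:: i] => g gi; apply: WU => /=; rewrite gi ?mem_head.
  by move=> /Ff.
move=> [s sA]; apply: filterS sA _.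
elim: s => [|i s IH]; first by apply: filterE => g i; rewrite in_nil.
apply: (filterS2 _ _ IH (_ : nbhs f [set g | g i = f i])).
  by move=> g gs gi j; rewrite inE => /orP[/eqP->|/gs].
have := @proj_continuous I K i f [set x | x = f i].
by apply; apply/K_discrete.
Qed.

End DiscreteProduct.

Lemma nbhs_ptws_bool (x : {ptws int -> bool}) (A : set {ptws int -> bool}) :
  nbhs x A <->
  exists s : seq int, forall y, (forall n, n \in s -> y n = x n) -> A y.
Proof.
apply: nbhs_discrete_product => _ b U; rewrite nbhs_principalE.
by split=> /principal_filterP.
Qed.

(** * Cylinders in the product of residues, the group H and the window *)

Section Residues.
Variable B : set nat.
Hypothesis B_pos : forall b, B b -> (0 < b)%N.
Implicit Types (b : B) (h g : residues B) (n m k : int) (S : {fset nat}).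

Lemma val_B b : B (val b).
Proof. by have := valP b; rewrite inE. Qed.

Lemma val_B_gt0 b : (0 < val b)%N.
Proof. exact/B_pos/val_B. Qed.

(** Describes the basic neighbourhoods; elements of [S] outside [B] impose nothing. *)
Definition agree S h g := forall b, val b \in S -> h b = g b.

Lemma nbhs_residues h (A : set (residues B)) : nbhs h A <->
  exists2 S : {fset nat}, [set` S] `<=` B & forall g, agree S h g -> A g.
Proof.
rewrite (@nbhs_discrete_product _ _ _ h A); last first.
  move=> b x U; rewrite nbhs_principalE.
  by split=> /principal_filterP.
split=> [[s sA]|[S SB SA]].
  exists [fset val b | b in s]%fset.
    by move=> _ /imfsetP[b _ ->]; exact: val_B.
  move=> g gS; apply: sA => b bs; symmetry; apply: gS.
  by apply/imfsetP; exists b.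
exists (pmap insub (enum_fset S)) => g gS; apply: SA => b bS.
symmetry; apply: gS; rewrite mem_pmap; apply/mapP; exists (val b) => //.
by rewrite valK.
Qed.

Lemma Delta_eq n m b : Delta B n b = Delta B m b <-> ((val b)%:Z %| n - m)%Z.
Proof.
have b0 : (val b)%:Z != 0 by have := val_B_gt0 b; case: (val b).
have lt_b k : (`|(k %% (val b)%:Z)%Z| < (val b).-1.+1)%N.
  rewrite prednK ?val_B_gt0 // -ltz_nat gez0_abs ?modz_ge0 //.
  by rewrite ltz_mod.
rewrite -eqz_mod_dvd; split=> [/(congr1 val)|/eqP nm]; last by rewrite /Delta nm.
rewrite /= !modn_small // => /(congr1 Posz).
by rewrite !gez0_abs ?modz_ge0 // => /eqP.
Qed.

Lemma Delta0 : Delta B 0 = 0.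
Proof.
apply/functional_extensionality_dep => b; apply: val_inj.
by rewrite /= mod0z mod0n.
Qed.

Lemma Delta_eq0 n b : Delta B n b = (0 : 'I_(val b).-1.+1) <-> ((val b)%:Z %| n)%Z.
Proof.
by rewrite -[n in (_ %| n)%Z]subr0 -Delta_eq Delta0.
Qed.

Lemma DeltaD n m : Delta B (n + m) = Delta B n + Delta B m.
Proof.
apply/functional_extensionality_dep => b; apply: val_inj.
have b0 : (val b)%:Z != 0 by have := val_B_gt0 b; case: (val b).
have bE := prednK (val_B_gt0 b).
have modE k : Posz (`|(k %% (val b)%:Z)%Z| %% (val b).-1.+1)%N = (k %% (val b)%:Z)%Z.
  rewrite bE modn_small ?gez0_abs ?modz_ge0 //.
  by rewrite -ltz_nat gez0_abs ?modz_ge0 // ltz_mod.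
apply/eqP; rewrite -eqz_nat; apply/eqP.
rewrite /Delta modE /=.
rewrite -modz_nat PoszD !modE bE.
by rewrite modzDm.
Qed.

Lemma group_HP h : group_H B h <->
  forall S, [set` S] `<=` B -> exists n, agree S h (Delta B n).
Proof.
split=> [hH S SB|hS A /nbhs_residues[S SB SA]].
  have /hH[_ [[n _ <-] hn]] : nbhs h [set g | agree S h g].
    by apply/nbhs_residues; exists S.
  by exists n.
by have [n hn] := hS S SB; exists (Delta B n); split; [exists n|exact: SA].
Qed.

Lemma Delta_group_H n : group_H B (Delta B n).
Proof. by apply/group_HP => S SB; exists n. Qed.

Lemma agreeD S h h' g g' : agree S h h' -> agree S g g' -> agree S (h + g) (h' + g').
Proof.
move=> hh' gg' b bS.
have E x y : (x + y : residues B) b = (x b : 'I_(val b).-1.+1) + (y b : 'I_(val b).-1.+1).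
  by [].
by rewrite !E hh' // gg'.
Qed.

Lemma group_HD h n : group_H B h -> group_H B (h + Delta B n).
Proof.
move=> /group_HP hH; apply/group_HP => S /hH[m hm]; exists (m + n).
by rewrite DeltaD; apply: agreeD.
Qed.

Lemma lcm_fset_gt0 S : [set` S] `<=` B -> (0 < lcm_fset S)%N.
Proof.
move=> SB; rewrite /lcm_fset big_seq; elim/big_ind: _ => // [x y x0 y0|b bS].
  by rewrite lcmn_gt0 x0.
by apply: B_pos; apply: SB.
Qed.

Lemma dvdn_lcm_fset S (c : nat) : c \in S -> (c %| lcm_fset S)%N.
Proof. by move=> cS; rewrite /lcm_fset (big_rem c) //= dvdn_lcml. Qed.

Lemma lcm_fset_dvdz S n : (forall c : nat, c \in S -> (c%:Z %| n)%Z) ->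
  ((lcm_fset S)%:Z %| n)%Z.
Proof.
move=> Sn; rewrite /lcm_fset big_seq; elim/big_ind: _ => [|x y xn yn|b /Sn //].
  by rewrite dvd1z.
by rewrite dvdzE /= dvdn_lcm; rewrite !dvdzE in xn yn; rewrite xn yn.
Qed.

Lemma lcm_fset_mono S S' : {subset S <= S'} -> (lcm_fset S %| lcm_fset S')%N.
Proof.
move=> SS'; have : ((lcm_fset S)%:Z %| (lcm_fset S')%:Z)%Z; last by rewrite dvdzE.
by apply: lcm_fset_dvdz => b /SS' bS; rewrite dvdzE dvdn_lcm_fset.
Qed.

Lemma agree_Delta S n m : [set` S] `<=` B ->
  agree S (Delta B n) (Delta B m) <-> ((lcm_fset S)%:Z %| n - m)%Z.
Proof.
move=> SB; split=> [nm|nm b bS].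
  apply: lcm_fset_dvdz => b bS.
  have bB : b \in B by rewrite inE; exact: SB.
  by have /Delta_eq := nm (exist _ b bB) bS.
apply/Delta_eq; apply: dvdz_trans nm.
by rewrite dvdzE dvdn_lcm_fset.
Qed.

Lemma agree_sub S S' h g : {subset S <= S'} -> agree S' h g -> agree S h g.
Proof. by move=> SS' hg b /SS'; apply: hg. Qed.

Lemma agree_sym S h g : agree S h g -> agree S g h.
Proof. by move=> hg b /hg. Qed.

Lemma agree_trans S g h h' : agree S h g -> agree S g h' -> agree S h h'.
Proof. by move=> hg gk b bS; rewrite hg // gk. Qed.

Lemma multiplesP n : multiples B n <-> exists b, ((val b)%:Z %| n)%Z.
Proof.
split=> [[b Bb bn]|[b bn]]; last by exists (val b) => //; exact: val_B.
have bB : b \in B by rewrite inE.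
by exists (exist _ b bB).
Qed.

Lemma window_Delta n : window B (Delta B n) <-> ~ multiples B n.
Proof.
split=> [[_ nb] /multiplesP[b bn]|nM].
  by apply: (nb b); apply/Delta_eq0.
split; first exact: Delta_group_H.
by move=> b /Delta_eq0 bn; apply: nM; apply/multiplesP; exists b.
Qed.

Lemma eta_seqE n : eta_seq B n = (n \notin multiples B).
Proof.
rewrite /eta_seq /phi add0r; apply/idP/idP; rewrite !inE notin_setE.
  by move/window_Delta.
by move/window_Delta.
Qed.

(** The window is closed in the product: H is closed, and each condition [h b <> 0] involves a
    single coordinate. *)
Lemma closed_window h : (forall S, [set` S] `<=` B ->
  exists2 g, window B g & agree S h g) -> window B h.
Proof.
move=> hS; split.
  apply/group_HP => S SB; have [g [/group_HP/(_ S SB)[n gn] _] hg] := hS S SB.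
  by exists n; apply: agree_trans gn.
move=> b hb.
have SB : [set` [fset val b]%fset] `<=` B.
  by move=> c /=; rewrite inE => /eqP ->; exact: val_B.
have [g [_ gW] hg] := hS _ SB.
by apply: (gW b); rewrite -hg ?inE ?eqxx.
Qed.

Lemma closure_residuesP (A : set (residues B)) h : closure A h <->
  forall S, [set` S] `<=` B -> exists2 g, A g & agree S h g.
Proof.
split=> [hA S SB|hS U /nbhs_residues[S SB SU]].
  have /hA[g [Ag hg]] : nbhs h [set g | agree S h g].
    by apply/nbhs_residues; exists S.
  by exists g.
by have [g Ag hg] := hS S SB; exists g; split => //; exact: SU.
Qed.

Lemma closure_window_sub (A : set (residues B)) : A `<=` window B ->
  closure A `<=` window B.
Proof.
move=> AW h /closure_residuesP hA; apply: closed_window => S /hA[g /AW gW hg].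
by exists g.
Qed.

Lemma int_windowP h : int_window B h <->
  group_H B h /\ exists2 S : {fset nat}, [set` S] `<=` B &
    forall g, group_H B g -> agree S h g -> window B g.
Proof.
rewrite -[int_window B h]/(nbhs_subspace (h : subspace (group_H B)) (window B)).
(* Outside H the points of [subspace] are isolated, but they do not lie in the window. *)
have [hH|hH] := pselect (group_H B h); last first.
  rewrite -(nbhs_subspace_out hH); split=> [/(_ h erefl)[]|[]] //.
rewrite -(nbhs_subspace_in hH); split=> [/nbhs_residues[S SB Sh]|[_ [S SB Sh]]].
  by split=> //; exists S => // g gH /Sh /(_ gH).
by apply/nbhs_residues; exists S => // g hg gH; apply: Sh.
Qed.

End Residues.

(** * Scaled coprime families and the sets F_{A_S} *)

Section CoprimeFamilies.
Implicit Types (A C : set nat).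

(** Each new element is coprime to all earlier ones, and since elements exceed 1 this also makes
    them distinct. *)
Lemma greedy_coprime C : (forall c, C c -> (1 < c)%N) ->
  (forall s : seq nat, (forall c, c \in s -> C c) ->
    exists2 c, C c & forall c', c' \in s -> coprime c c') ->
  exists A, [/\ A `<=` C, infinite_set A & pairwise_coprime A].
Proof.
move=> C1 step.
have /choice[next nextP] : forall s : seq nat, exists x : nat,
    (forall c, c \in s -> C c) -> C x /\ forall c', c' \in s -> coprime x c'.
  move=> s; have [sC|nsC] := pselect (forall c, c \in s -> C c).
    by have [c Cc cs] := step s sC; exists c.
  by exists 0%N.
pose L k := iter k (fun s => next s :: s) [::].
have LC k c : c \in L k -> C c.
  elim: k c => [|k IH] c; first by rewrite in_nil.
  by rewrite inE => /orP[/eqP->|/IH //]; exact: (nextP _ IH).1.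
pose f k := next (L k).
have fL j k : (j < k)%N -> f j \in L k.
  elim: k => // k IH; rewrite ltnS leq_eqVlt inE => /orP[/eqP->|/IH ->].
    by rewrite eqxx.
  by rewrite orbT.
have fC k : C (f k) by exact: (nextP _ (LC k)).1.
have f_co j k : j != k -> coprime (f j) (f k).
  wlog jk : j k / (j < k)%N => [hw|_].
    by rewrite neq_ltn => /orP[|] jk; [|rewrite coprime_sym]; apply: hw => //;
      rewrite neq_ltn jk ?orbT.
  by rewrite coprime_sym; apply: (nextP _ (LC k)).2; exact: fL.
have f_inj : injective f.
  move=> j k fjk; apply/eqP/negPn/negP => /f_co.
  rewrite fjk /coprime gcdnn => /eqP f1.
  by have := C1 _ (fC k); rewrite f1.
exists (range f); split.
- by move=> _ [k _ <-].
- have f_inj' : {in [set: nat] &, injective f} by move=> x y _ _; exact: f_inj.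
  by rewrite (eq_finite_set (inj_card_eq f_inj')); exact: infinite_nat.
- move=> _ _ [j _ <-] [k _ <-] jk; apply: f_co.
  by apply: contraNneq jk => ->.
Qed.

(** Two distinct elements of [A] with the same gcd with [m] are coprime, so that gcd is 1. Were it
    never 1, [a] would be determined by [gcd(a, m) <= m] and [A] would be finite. *)
Lemma coprime_of_infinite A m : infinite_set A -> pairwise_coprime A ->
  (0 < m)%N -> exists2 a, A a & coprime a m.
Proof.
move=> Ainf Aco m0; apply: contrapT => noA; apply: Ainf.
pose f d := xget 0%N [set a | A a /\ gcdn a m = d].
apply: (@sub_finite_set _ _ (f @` `I_m.+1)); last exact: finite_image.
move=> a Aa; exists (gcdn a m).
  by rewrite /= ltnS dvdn_leq ?dvdn_gcdr.
have [Afa fa] : A (f (gcdn a m)) /\ gcdn (f (gcdn a m)) m = gcdn a m.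
  by rewrite /f; case: xgetP => [x _ //|/(_ a)[]].
apply: contrapT => /eqP /(Aco _ _ Afa Aa) co.
apply: noA; exists a => //.
have : (gcdn a m %| gcdn (f (gcdn a m)) a)%N.
  by rewrite dvdn_gcd dvdn_gcdl -{1}fa dvdn_gcdl.
by rewrite (eqP co) dvdn1.
Qed.

End CoprimeFamilies.

(** The configuration that (B4) excludes. *)
Definition scaled_coprime (B : set nat) : Prop :=
  exists (d : nat) (A : set nat),
    [/\ (0 < d)%N, infinite_set A, forall a, A a -> (1 < a)%N,
        pairwise_coprime A & [set (d * a)%N | a in A] `<=` B].

Lemma dvdz_nat (m n : nat) : (m%:Z %| n%:Z)%Z = (m %| n)%N.
Proof. by rewrite dvdzE. Qed.

Lemma dvdzNr (d n : int) : (d %| - n)%Z = (d %| n)%Z.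
Proof. by rewrite !dvdzE abszN. Qed.

(** * The arithmetic conditions (B2)-(B4) and tautness *)

Section Arithmetic.
Variable B : set nat.
Hypothesis B_pos : forall b, B b -> (0 < b)%N.
Hypothesis B_primitive : primitive B.
Implicit Types (S : {fset nat}) (n m k : int).

Lemma free_A_E S n : free_numbers (A_ B S) n <->
  forall b, B b -> ~~ ((gcdn b (lcm_fset S))%:Z %| n)%Z.
Proof.
split=> [nF b Bb|nb].
  by apply/negP => bn; apply: nF; exists (gcdn b (lcm_fset S)) => //; exists b.
by move=> [_ [b Bb <-] bn]; have /negP := nb b Bb; apply.
Qed.

(** By Bezout, [gcd(b, lcm S)] divides [n] exactly when [b] divides some [n + k * lcm S]. *)
Lemma free_A_P S n : free_numbers (A_ B S) n <->
  forall k, free_numbers B (n + k * (lcm_fset S)%:Z).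
Proof.
rewrite free_A_E; set s := lcm_fset S; split=> [nF k [b Bb bn]|nF b Bb].
  have /negP := nF b Bb; apply.
  rewrite -(rpredDr _ (_ : k * s%:Z \in dvdz (gcdn b s)%:Z)).
    by apply: dvdz_trans bn; rewrite dvdz_nat dvdn_gcdl.
  by rewrite dvdz_mull // dvdz_nat dvdn_gcdr.
apply/negP => /dvdzP[q nq].
have [u [v uv]] := Bezoutz b%:Z s%:Z.
apply: (nF (- (q * v))); exists b => //.
have -> : n + - (q * v) * s%:Z = q * u * b%:Z.
  by rewrite nq -[(gcdn b s)%:Z]/(gcdz b%:Z s%:Z) -uv; ring.
by rewrite dvdz_mull.
Qed.

Lemma free_A_sub S n : free_numbers (A_ B S) n -> free_numbers B n.
Proof. by move=> /free_A_P /(_ 0); rewrite mul0r addr0. Qed.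

Lemma free_A_mono S S' n : {subset S <= S'} ->
  free_numbers (A_ B S) n -> free_numbers (A_ B S') n.
Proof.
move=> SS' /free_A_P nF; apply/free_A_P => k.
have /dvdnP[q ->] := lcm_fset_mono SS'.
by rewrite PoszM mulrA; apply: nF.
Qed.

Definition locally_free := forall n, free_numbers B n ->
  exists2 S : {fset nat}, [set` S] `<=` B & free_numbers (A_ B S) n.

Lemma locally_freeP : free_numbers B =
  \bigcup_(S in [set S : {fset nat} | [set` S] `<=` B]) free_numbers (A_ B S)
  <-> locally_free.
Proof.
split=> [E n|lf]; first by rewrite {1}E => -[S SB nF]; exists S.
apply/seteqP; split=> n; first by move=> /lf[S SB nF]; exists S.
by move=> [S SB /free_A_sub].
Qed.

Lemma B_gt1 : infinite_set B -> forall b, B b -> (1 < b)%N.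
Proof.
move=> Binf b Bb; rewrite ltn_neqAle B_pos // andbT; apply/eqP => b1.
apply: Binf; apply: (@sub_finite_set _ _ [set 1%N]); last exact: finite_set1.
move=> c Bc; apply/eqP/negPn/negP => c1; rewrite -b1 in Bb.
have := B_primitive Bb Bc; rewrite eq_sym => /(_ c1).
by rewrite dvd1n.
Qed.

(** A divisor [b] of [d] in [B] divides [d * a], hence equals it by primitivity; but [d * a] does
    not divide [d]. *)
Lemma scale_free d (A : set nat) : infinite_set A ->
  (forall a, A a -> (1 < a)%N) -> [set (d * a)%N | a in A] `<=` B ->
  free_numbers B d%:Z.
Proof.
move=> /infinite_setN0[a Aa] A1 dAB [b Bb bd].
have Bda : B (d * a)%N by apply: dAB; exists a.
have : b == (d * a)%N.
  apply/negPn/negP => /(B_primitive Bb Bda)/negP; apply.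
  by rewrite dvdn_mulr // -dvdz_nat.
move/eqP => bE; have d0 : (0 < d)%N.
  by have := B_pos Bda; rewrite muln_gt0 => /andP[].
move: bd; rewrite dvdz_nat bE -{2}[d]muln1 dvdn_pmul2l // dvdn1 => /eqP a1.
by have := A1 a Aa; rewrite a1.
Qed.

Lemma scaled_coprime_blocks d (A : set nat) n : infinite_set A ->
  pairwise_coprime A -> [set (d * a)%N | a in A] `<=` B -> (d%:Z %| n)%Z ->
  forall S, [set` S] `<=` B -> ~ free_numbers (A_ B S) n.
Proof.
move=> Ainf Aco dAB dn S SB /free_A_E nF.
have [a Aa a_co] := coprime_of_infinite Ainf Aco (lcm_fset_gt0 B_pos SB).
have /negP := nF (d * a)%N (dAB _ (ex_intro2 _ _ a Aa erefl)); apply.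
apply: dvdz_trans dn; rewrite dvdz_nat gcdnC Gauss_gcdl ?dvdn_gcdr //.
by rewrite coprime_sym.
Qed.

Lemma locally_free_not_scaled : locally_free -> ~ scaled_coprime B.
Proof.
move=> lf [d [A [d0 Ainf A1 Aco dAB]]].
have [S SB dS] := lf _ (scale_free Ainf A1 dAB).
exact: (scaled_coprime_blocks Ainf Aco dAB _ SB dS).
Qed.

(** For [n] in [A_infty], every finite [S] admits [b = n * c] in [B] with [gcd(b, lcm S') = n] for
    some larger [S']. Then [c] is coprime to every [c'] with [n * c'] in [S], which feeds the greedy
    construction. *)
Lemma not_scaled_A_infty : ~ scaled_coprime B -> A_infty B = set0.
Proof.
move=> nsc; apply/seteqP; split=> // n [n0 nP]; exfalso; apply: nsc.
have nB : ~ B n.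
  move=> Bn; have SB : [set` [fset n]%fset] `<=` B.
    by move=> c /=; rewrite inE => /eqP ->.
  have [S' [_ SS' _ /negP]] := nP _ SB; apply.
  by apply: SS'; rewrite /= inE.
pose C := [set c | B (n * c)%N].
have C1 c : C c -> (1 < c)%N.
  move=> Bc; have := B_pos Bc; rewrite muln_gt0 => /andP[_ c0].
  rewrite ltn_neqAle c0 andbT; apply/eqP => c1.
  by apply: nB; move: Bc; rewrite /C /= -c1 muln1.
have [|A [AC Ainf Aco]] := greedy_coprime C1; last first.
  exists n, A; split => //; first by move=> a /AC /C1.
  by move=> _ [a /AC Ca <-].
move=> s sC; pose S := [fset (n * c)%N | c in s]%fset.
have SB : [set` S] `<=` B by move=> _ /imfsetP[c /= cs ->]; exact: sC.
have [S' [S'B SS' [b Bb bn] nS']] := nP S SB.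
have /dvdnP[c bE] : (n %| b)%N by rewrite -bn dvdn_gcdl.
exists c; first by rewrite /C /= mulnC -bE.
move=> c' c's; rewrite /coprime -(eqn_pmul2l n0) muln_gcdr muln1 eqn_dvd.
have nc : (n * c = b)%N by rewrite mulnC bE.
rewrite nc; apply/andP; split; last by rewrite dvdn_gcd -nc !dvdn_mulr.
rewrite -[X in (_ %| X)%N]bn dvdn_gcd dvdn_gcdl (dvdn_trans (dvdn_gcdr _ _)) //.
by apply: dvdn_lcm_fset; apply: SS'; apply/imfsetP; exists c'.
Qed.

(** A free [n] is nonzero, so it has finitely many divisors; as none lies in [A_infty], one [S] is
    large enough for all of them. If [gcd(b, lcm S)] divided [n], it would belong to [S], hence to
    [B]. *)
Lemma A_infty_locally_free : B !=set0 -> A_infty B = set0 -> locally_free.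
Proof.
move=> [b0 Bb0] A0 n nF.
have bound (ds : seq nat) : (forall e, e \in ds -> (0 < e)%N) ->
    exists2 S : {fset nat}, [set` S] `<=` B & forall e, e \in ds ->
      forall S' : {fset nat}, [set` S'] `<=` B -> {subset S <= S'} ->
      A_ B S' e -> e \in S'.
  elim: ds => [|e ds IH] ds0; first by exists fset0 => // c; rewrite inE.
  have [|S SB Sds] := IH; first by move=> c cds; rewrite ds0 // inE cds orbT.
  have [Se SeB See] : exists2 Se : {fset nat}, [set` Se] `<=` B &
      forall S' : {fset nat}, [set` S'] `<=` B -> {subset Se <= S'} ->
      A_ B S' e -> e \in S'.
    apply: contrapT => nSe; suff : A_infty B e by rewrite A0.
    split=> [|Se SeB]; first by rewrite ds0 ?mem_head.
    apply: contrapT => nS'; apply: nSe; exists Se => // S' S'B SeS' AS'.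
    by apply/negPn/negP => eS'; apply: nS'; exists S'; split.
  exists (S `|` Se)%fset.
    by move=> c /=; rewrite inE => /orP[/SB|/SeB].
  move=> c + S' S'B SS'; rewrite inE => /orP[/eqP->|cds].
    by apply: See => // x xS; apply: SS'; rewrite inE xS orbT.
  by apply: Sds => // x xS; apply: SS'; rewrite inE xS.
have n0 : (0 < `|n|)%N.
  by rewrite absz_gt0; apply/eqP => n0; apply: nF; exists b0 => //; rewrite n0 dvdz0.
have [|S SB Sn] := bound (divisors `|n|%N).
  by move=> e; rewrite -dvdn_divisors // => /(dvdn_gt0 n0).
exists S => //; apply/free_A_E => b Bb; apply/negP => bn.
have eS : gcdn b (lcm_fset S) \in S.
  apply: Sn => //; first by rewrite -dvdn_divisors //; rewrite dvdzE in bn.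
  by exists b.
by apply: nF; exists (gcdn b (lcm_fset S)) => //; exact: SB.
Qed.

(** Fix [b] and group the other [b'] by [e = gcd(b', b)]. The greedy construction fails on the
    quotients [b' / e], so some finite list shares a factor with each of them. The primes of these
    lists, over all [e] dividing [b], are what [free_inf_setD1] asks for. *)
Lemma not_scaled_taut (R : realType) : ~ scaled_coprime B -> taut R B.
Proof.
move=> nsc; apply/(tautP R B_pos) => b Bb.
pose C e := [set c | [/\ B (e * c)%N, gcdn (e * c) b = e & (e * c)%N != b]].
have C1 e c : C e c -> (1 < c)%N.
  move=> [Bec ge ecb]; have := B_pos Bec; rewrite muln_gt0 => /andP[_ c0].
  rewrite ltn_neqAle c0 andbT; apply/eqP => c1.
  have := B_primitive Bec Bb ecb; rewrite -c1 muln1 in ge *.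
  by rewrite -{1}ge dvdn_gcdr.
have hitting e : exists s : seq nat, (0 < e)%N ->
    (forall c, c \in s -> C e c) /\
    forall c, C e c -> exists2 c', c' \in s & ~~ coprime c c'.
  have [e0|] := posnP e; first by exists [::]; rewrite e0.
  move=> e0; apply: contrapT => nohit; apply: nsc.
  have [|A [AC Ainf Aco]] := greedy_coprime (@C1 e); last first.
    exists e, A; split => //; first by move=> a /AC /C1.
    by move=> _ [a /AC [Bea _ _] <-].
  move=> s sC; apply: contrapT => nc; apply: nohit; exists s => _; split=> // c Cc.
  apply: contrapT => nc'; apply: nc; exists c => // c' c's.
  by apply/negPn/negP => co; apply: nc'; exists c'.
have [s sP] := choice hitting.
pose t := flatten [seq flatten [seq primes c | c <- s e] | e <- divisors b].
apply: (@free_inf_setD1 R B b t) => //.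
  move=> p /flattenP[_ /mapP[e _ ->]] /flattenP[_ /mapP[c _ ->]].
  by rewrite mem_primes => /andP[/prime_gt1].
move=> b' Bb' b'b; pose e := gcdn b' b.
have e0 : (0 < e)%N by rewrite gcdn_gt0 (B_pos Bb').
have b'E : (e * (b' %/ e) = b')%N by rewrite mulnC divnK ?dvdn_gcdl.
have [sC sH] := sP e e0.
have Cb' : C e (b' %/ e)%N by split; rewrite b'E.
have [c cs nco] := sH _ Cb'.
have g1 : (1 < gcdn (b' %/ e) c)%N.
  rewrite ltn_neqAle eq_sym nco gcdn_gt0.
  by have := C1 _ _ Cb' => /ltnW ->.
exists (pdiv (gcdn (b' %/ e) c)).
  apply/flattenP; exists (flatten [seq primes c | c <- s e]).
    by apply/mapP; exists e => //; rewrite -dvdn_divisors ?B_pos // dvdn_gcdr.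
  apply/flattenP; exists (primes c); first by apply/mapP; exists c.
  rewrite mem_primes pdiv_prime //.
  have := C1 _ _ (sC _ cs) => /ltnW -> /=.
  exact: dvdn_trans (pdiv_dvd _) (dvdn_gcdr _ _).
exact: dvdn_trans (pdiv_dvd _) (dvdn_gcdl _ _).
Qed.

End Arithmetic.

(** * Regularity of the window *)

Section Regularity.
Variable B : set nat.
Hypothesis B_pos : forall b, B b -> (0 < b)%N.
Hypothesis B_primitive : primitive B.
Implicit Types (S : {fset nat}) (n m k : int).

(** A point [g] of the cylinder with [g b = 0] is matched on [S] and [b] by some [Delta m]; then [b]
    divides [m], while [m] is congruent to [n] modulo [lcm S]. *)
Lemma int_window_Delta S n : [set` S] `<=` B -> free_numbers (A_ B S) n ->
  int_window B (Delta B n).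
Proof.
move=> SB nF; apply/int_windowP; split; first exact: Delta_group_H.
exists S => // g gH ng; split=> // b gb.
have SbB : [set` (val b |` S)%fset] `<=` B.
  by move=> c /=; rewrite !inE => /orP[/eqP->|/SB //]; exact: val_B.
have [m gm] := (group_HP g).1 gH _ SbB.
have bm : ((val b)%:Z %| m)%Z.
  by apply/(Delta_eq0 B_pos); rewrite -gm ?gb // !inE eqxx.
have /(agree_Delta B_pos _ _ SB) : agree S (Delta B m) (Delta B n).
  apply: agree_sym; apply: agree_trans ng _.
  by apply: agree_sub gm => c cS; rewrite inE cS orbT.
move=> /dvdzP[q mn]; have := (free_A_P B S n).1 nF q; apply.
by rewrite -mn addrC subrK; exists (val b) => //; exact: val_B.
Qed.

(** If a cylinder over [S0] around [h] lies in the window and contains [Delta n], it contains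
    [Delta] of every [n + k * lcm S0]. *)
Lemma int_window_free h : int_window B h -> forall S, [set` S] `<=` B ->
  exists S' n, [/\ [set` S'] `<=` B, {subset S <= S'},
    agree S' h (Delta B n) & free_numbers (A_ B S') n].
Proof.
move=> /int_windowP[hH [S0 S0B hW]] S SB.
have S'B : [set` (S `|` S0)%fset] `<=` B.
  by move=> c /=; rewrite inE => /orP[/SB|/S0B].
have sub0 : {subset S0 <= (S `|` S0)%fset} by move=> c c0; rewrite inE c0 orbT.
have [n hn] := (group_HP h).1 hH _ S'B.
exists (S `|` S0)%fset, n; split=> //; first by move=> c cS; rewrite inE cS.
apply: (free_A_mono sub0); apply/free_A_P => k.
apply/(window_Delta B_pos); apply: hW; first exact: Delta_group_H.
apply: agree_trans (agree_sub sub0 hn) _.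
by apply/agree_Delta => //; rewrite opprD addNKr dvdzNr dvdz_mull.
Qed.

(** [Delta d] lies in the window, so an interior point agrees with it at the coordinate [d * a0].
    This yields a multiple [n] of [d] in some F_{A_S'}, which [scaled_coprime_blocks] forbids. *)
Lemma regular_not_scaled : closure (int_window B) = window B ->
  ~ scaled_coprime B.
Proof.
move=> reg [d [A [d0 Ainf A1 Aco dAB]]].
have [a0 Aa0] := infinite_setN0 Ainf.
have Bda0 : B (d * a0)%N by apply: dAB; exists a0.
have SB : [set` [fset d * a0]%N%fset] `<=` B.
  by move=> c /=; rewrite inE => /eqP ->.
have : window B (Delta B d).
  by apply/(window_Delta B_pos); exact: (scale_free B_pos B_primitive Ainf A1 dAB).
rewrite -reg => /closure_residuesP/(_ _ SB)[g gW dg].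
have [S' [n [S'B SS' gn nF]]] := int_window_free gW SB.
apply: (scaled_coprime_blocks B_pos Ainf Aco dAB _ S'B nF).
have /(agree_Delta B_pos _ _ SB) : agree [fset d * a0]%N%fset (Delta B d) (Delta B n).
  by apply: agree_trans dg _; apply: agree_sub gn.
have dl : (d%:Z %| (lcm_fset [fset (d * a0)%N]%fset)%:Z)%Z.
  rewrite dvdz_nat; apply: (@dvdn_trans (d * a0)%N); first by rewrite dvdn_mulr.
  by apply: dvdn_lcm_fset; rewrite inE.
move=> /(dvdz_trans dl); rewrite -opprB dvdzNr => dnd.
by rewrite -(subrK d%:Z n) rpredD // dvdzz.
Qed.

Lemma taut_dense (R : realType) : taut R B ->
  closure (range (Delta B) `&` window B) = window B.
Proof.
move=> B_taut; apply/seteqP; split.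
  by apply: closure_window_sub => // h [].
move=> h [hH hW]; apply/closure_residuesP => S SB.
have [n0 hn0] := (group_HP h).1 hH _ SB.
pose s := lcm_fset S; have s0 : (0 < s)%N := lcm_fset_gt0 B_pos SB.
have sz0 : s%:Z != 0 by rewrite eqz_nat -lt0n.
pose r := `|(n0 %% s%:Z)%Z|%N.
have rE : r%:Z = (n0 %% s%:Z)%Z by rewrite /r gez0_abs // modz_ge0.
have rn0 : (s%:Z %| n0 - r%:Z)%Z.
  by rewrite -eqz_mod_dvd rE modz_mod.
(* An element [b] of [B] dividing both [r] and [s] would force the coordinate [h b] to vanish. *)
have [k kr kfree] : exists2 k, k = r %[mod s] & ~~ hit B k.
  apply: (taut_progression B_pos B_taut s0) => b Bb; apply/negP.
  rewrite dvdn_gcd => /andP[br bs].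
  have bB : b \in B by rewrite inE.
  pose b' : B := exist _ b bB.
  have SbB : [set` (b |` S)%fset] `<=` B.
    by move=> c /=; rewrite !inE => /orP[/eqP->|/SB].
  have [m hm] := (group_HP h).1 hH _ SbB.
  apply: (hW b'); rewrite hm ?inE ?eqxx //; apply/(Delta_eq0 B_pos) => /=.
  have /(agree_Delta B_pos _ _ SB) mn0 : agree S (Delta B m) (Delta B n0).
    apply: agree_trans hn0; apply: agree_sym; apply: agree_sub hm => c cS.
    by rewrite inE cS orbT.
  have -> : m = (m - n0) + ((n0 - r%:Z) + r%:Z) by ring.
  rewrite rpredD //.
    by apply: dvdz_trans mn0; rewrite dvdz_nat.
  have br' : (b%:Z %| r%:Z)%Z by rewrite dvdz_nat.
  rewrite rpredD //.
  by apply: dvdz_trans rn0; rewrite dvdz_nat.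
exists (Delta B k).
  split; first by exists k.
  by apply/(window_Delta B_pos) => kM; move/negP: kfree; apply; rewrite /hit inE.
apply: agree_trans hn0 _; apply/agree_Delta => //.
rewrite -eqz_mod_dvd; apply/eqP; rewrite modz_nat kr -modz_nat.
by rewrite rE modz_mod.
Qed.

Lemma locally_free_regular : locally_free B ->
  closure (range (Delta B) `&` window B) = window B ->
  closure (int_window B) = window B.
Proof.
move=> lf dense; apply/seteqP; split.
  apply: closure_window_sub => // h /int_windowP[hH [S SB]].
  by apply=> // b.
move=> h; rewrite -{1}dense => /closure_residuesP hd.
apply/closure_residuesP => S SB.
have [_ [[n _ <-] /(window_Delta B_pos) nF] hn] := hd S SB.
have [S' S'B nS'] := lf n nF.
by exists (Delta B n) => //; exact: int_window_Delta nS'.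
Qed.

Lemma eta_free n : eta_seq B n <-> free_numbers B n.
Proof. by rewrite eta_seqE // notin_setE. Qed.

Lemma eta_eq n m : (free_numbers B n <-> free_numbers B m) ->
  eta_seq B n = eta_seq B m.
Proof. by move=> nm; apply/idP/idP => /eta_free/nm/eta_free. Qed.

(** A period at a free [n] is [lcm S]; at a multiple of [b] it is [b]. *)
Lemma locally_free_toeplitz : locally_free B -> toeplitz (eta_seq B).
Proof.
move=> lf n; have [nF|/contrapT nM] := pselect (free_numbers B n).
  have [S SB nS] := lf n nF.
  have s0 := lcm_fset_gt0 B_pos SB.
  exists (lcm_fset S) => // j; apply: eta_eq; split=> // _.
  exact: ((free_A_P B S n).1 nS).
have [b Bb bn] := nM.
exists b; first exact: B_pos.
move=> j; apply: eta_eq; split=> //.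
by case; exists b => //; rewrite rpredD // dvdz_mull.
Qed.

(** Choose [S] with [gcd(m, lcm S)] largest, [m] being a period at [n]. If [b] divides
    [n + k * lcm S], then [k * lcm S] is an integer combination of [m] and of a multiple of [b], so
    [b] divides some [n + j * m], which is free. *)
Lemma toeplitz_locally_free : toeplitz (eta_seq B) -> locally_free B.
Proof.
move=> tp n nF; have [m m0 mP] := tp n.
have mF k : free_numbers B (n + k * m%:Z) by apply/eta_free; rewrite mP; apply/eta_free.
have [S SB Smax] : exists2 S : {fset nat}, [set` S] `<=` B &
    forall S', [set` S'] `<=` B -> (gcdn m (lcm_fset S') %| gcdn m (lcm_fset S))%N.
  pose V v := `[< exists2 S : {fset nat}, [set` S] `<=` B & gcdn m (lcm_fset S) = v >].
  have Vex : exists v, V v.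
    by exists (gcdn m (lcm_fset fset0)); apply/asboolP; exists fset0.
  have Vle v : V v -> (v <= m)%N.
    by move=> /asboolP[S _ <-]; rewrite dvdn_leq ?dvdn_gcdl.
  have [_ /asboolP[S SB <-] Smax] := ex_maxnP Vex Vle.
  exists S => // S' S'B.
  have UB : [set` (S `|` S')%fset] `<=` B.
    by move=> c /=; rewrite inE => /orP[/SB|/S'B].
  have dvdU T : {subset T <= (S `|` S')%fset} ->
      (gcdn m (lcm_fset T) %| gcdn m (lcm_fset (S `|` S')%fset))%N.
    move=> TU; rewrite dvdn_gcd dvdn_gcdl /=.
    exact: dvdn_trans (dvdn_gcdr _ _) (lcm_fset_mono TU).
  have -> : gcdn m (lcm_fset S) = gcdn m (lcm_fset (S `|` S')%fset).
    apply/eqP; rewrite eqn_leq dvdn_leq ?gcdn_gt0 ?m0 ?dvdU //=; last first.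
      by move=> c cS; rewrite inE cS.
    by apply: Smax; apply/asboolP; exists (S `|` S')%fset.
  by apply: dvdU => c cS; rewrite inE cS orbT.
exists S => //; apply/free_A_P => k [b Bb bn].
have SbB : [set` (b |` S)%fset] `<=` B.
  by move=> c /=; rewrite !inE => /orP[/eqP->|/SB].
set s' := lcm_fset (b |` S)%fset.
have bs' : (b %| s')%N by apply: dvdn_lcm_fset; rewrite !inE eqxx.
have /dvdnP[t st] : (gcdn m s' %| lcm_fset S)%N.
  exact: dvdn_trans (Smax _ SbB) (dvdn_gcdr _ _).
have [u [v uv]] := Bezoutz m%:Z s'%:Z.
apply: (mF (k * t%:Z * u)); exists b => //.
have -> : n + k * t%:Z * u * m%:Z =
    n + k * (lcm_fset S)%:Z - k * t%:Z * v * s'%:Z.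
  by rewrite st PoszM -[Posz (gcdn m s')]/(gcdz m%:Z s'%:Z) -uv; ring.
by rewrite rpredB // dvdz_mull // dvdz_nat.
Qed.

Lemma C_phi0P : C_phi B 0 <-> forall n, exists2 S : {fset nat}, [set` S] `<=` B &
  forall h, group_H B h -> agree S 0 h -> phi h n = eta_seq B n.
Proof.
have H0 : group_H B 0 by rewrite -(Delta0 B); exact: Delta_group_H.
have nbhsE (A : set (residues B)) :
    nbhs (0 : subspace (group_H B)) A = within (group_H B) (nbhs (0 : residues B)) A.
  by rewrite (nbhs_subspace_in H0).
split=> [[_ cphi] n|Sn].
  have /cphi : nbhs (eta_seq B) [set y : {ptws int -> bool} | y n = eta_seq B n].
    by apply/nbhs_ptws_bool; exists [:: n] => y; apply; rewrite mem_head.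
  move=> n_phi; have : nbhs (0 : subspace (group_H B))
      (@phi B @^-1` [set y : {ptws int -> bool} | y n = eta_seq B n]) := n_phi.
  rewrite nbhsE => /nbhs_residues[S SB Sh].
  by exists S => // h hH /Sh /(_ hH).
split=> // A /nbhs_ptws_bool[s sA].
suff : nbhs (0 : subspace (group_H B)) (@phi B @^-1` A) by [].
rewrite nbhsE; apply/nbhs_residues.
have [S SB Sh] : exists2 S : {fset nat}, [set` S] `<=` B &
    forall h, group_H B h -> agree S 0 h ->
    forall n, n \in s -> phi h n = eta_seq B n.
  elim: s {sA} => [|n s [S SB Sh]]; first by exists fset0.
  have [S' S'B S'h] := Sn n.
  exists (S `|` S')%fset; first by move=> c /=; rewrite inE => /orP[/SB|/S'B].
  move=> h hH hS k; rewrite inE => /orP[/eqP->|ks].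
    by apply: S'h => //; apply: agree_sub hS => c cS; rewrite inE cS orbT.
  by apply: Sh => //; apply: agree_sub hS => c cS; rewrite inE cS.
by exists S => // h hS hH; apply: sA; exact: Sh.
Qed.

Lemma phiE h n : phi h n = ((h + Delta B n) \in window B).
Proof. by []. Qed.

(** At a free [n], [Delta n] is interior to the window; at a multiple of [b], the coordinate [b]
    alone decides the value. *)
Lemma locally_free_C_phi : locally_free B -> C_phi B 0.
Proof.
move=> lf; apply/C_phi0P => n; have [nF|/contrapT nM] := pselect (free_numbers B n).
  have [S SB nS] := lf n nF.
  have /int_windowP[_ [S' S'B S'W]] := int_window_Delta SB nS.
  exists S' => // h hH h0.
  have -> : eta_seq B n = true by apply/eta_free.
  rewrite phiE; apply/mem_set; apply: S'W; first exact: group_HD.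
  by have := agreeD h0 (fun c _ => erefl (Delta B n c)); rewrite add0r.
have [b bn] := (multiplesP B n).1 nM.
have bB : [set` [fset val b]%fset] `<=` B.
  by move=> c /=; rewrite inE => /eqP ->; exact: val_B.
exists [fset val b]%fset => // h hH h0.
have -> : eta_seq B n = false by apply/negP => /eta_free.
rewrite phiE; apply/negP; rewrite inE => -[_ /(_ b)]; apply.
have := agreeD h0 (fun c _ => erefl (Delta B n c)).
move=> /(_ b); rewrite inE eqxx add0r => <- //.
exact/Delta_eq0.
Qed.

(** [Delta (k * lcm S)] agrees with 0 on [S], so continuity forces [n + k * lcm S] to be free. *)
Lemma C_phi_locally_free : C_phi B 0 -> locally_free B.
Proof.
move=> /C_phi0P cphi n nF; have [S SB Sh] := cphi n.
exists S => //; apply/free_A_P => k.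
have : phi (Delta B (k * (lcm_fset S)%:Z)) n.
  rewrite Sh; first exact/eta_free; first exact: Delta_group_H.
  rewrite -(Delta0 B); apply/agree_Delta => //.
  by rewrite sub0r dvdzNr dvdz_mull.
by rewrite phiE -DeltaD // inE addrC => /window_Delta; apply.
Qed.

End Regularity.

(** * Dynamics of X_eta *)

Section Sequences.
Implicit Types (x y z : {ptws int -> bool}) (n m k : int) (N X : set {ptws int -> bool}).

Lemma closure_ptwsP N x : closure N x <->
  forall s : seq int, exists2 y, N y & forall n, n \in s -> y n = x n.
Proof.
split=> [Nx s|Nx A /nbhs_ptws_bool[s sA]].
  have /Nx[y [Ny yx]] : nbhs x [set y | forall n, n \in s -> y n = x n].
    by apply/nbhs_ptws_bool; exists s.
  by exists y.
by have [y Ny yx] := Nx s; exists y; split => //; exact: sA.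
Qed.

Lemma shift_byD k m x : shift_by k (shift_by m x) = shift_by (k + m) x.
Proof. by apply/funext => n; rewrite /shift_by addrA. Qed.

Lemma shift_by0 x : shift_by 0 x = x.
Proof. by apply/funext => n; rewrite /shift_by addr0. Qed.

(* Compactness of the full shift, along an ultrafilter on the translations. *)
Lemma orbit_limit (F : set_system int) y : ProperFilter F ->
  exists x, forall (s : seq int) (Q : set int), F Q ->
    exists2 k, Q k & forall n, n \in s -> x n = y (n + k).
Proof.
move=> FF; have [U [UU FU]] := ultraFilterLemma FF.
pose x : {ptws int -> bool} := fun n => `[< U [set k | y (n + k)] >].
exists x => s Q /FU UQ.
have Us : U [set k | forall n, n \in s -> x n = y (n + k)].
  elim: s => [|n s IH]; first by apply: filterE => k n; rewrite in_nil.
  have Un : U [set k | x n = y (n + k)].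
    rewrite /x; case: asboolP => [Un|nUn].
      by apply: filterS Un => k /= ->.
    have [//|] := in_ultra_setVsetC [set k | y (n + k)] UU.
    by apply: filterS => k /= /negP/negbTE ->.
  apply: filterS2 IH Un => k ks kn m.
  by rewrite inE => /orP[/eqP->|/ks].
by have [k [Qk ks]] := filter_ex (filterI UQ Us); exists k.
Qed.

(** Backward shifts stay in [N] because [sigma] maps [N] onto itself and is inverted by
    [shift_by (-1)]. *)
Lemma subsystem_shift N x k : subsystem N -> N x -> N (shift_by k x).
Proof.
move=> [_ _ sN] Nx.
have fwd (m : nat) z : N z -> N (shift_by m%:Z z).
  elim: m => [|m IH] Nz; first by rewrite shift_by0.
  rewrite -[m.+1]add1n PoszD -shift_byD -sN; exists (shift_by m%:Z z) => //.
  exact: IH.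
have bwd (m : nat) z : N z -> N (shift_by (- m%:Z) z).
  elim: m z => [|m IH] z Nz; first by rewrite oppr0 shift_by0.
  have [w Nw <-] : (sigma @` N) z by rewrite sN.
  have -> : shift_by (- m.+1%:Z) (sigma w) = shift_by (- m%:Z) w.
    rewrite /sigma shift_byD; congr (shift_by _ w).
    by rewrite -[m.+1]addn1 PoszD opprD addrNK.
  exact: IH.
case: k => m; first exact: fwd.
by rewrite NegzE; apply: bwd.
Qed.

Lemma subsystem_orbit_closure N y : subsystem N -> N y ->
  closure (range (fun k : int => shift_by k y)) `<=` N.
Proof.
move=> sN Ny; have [Ncl _ _] := sN.
rewrite [X in _ `<=` X]((closure_id N).1 Ncl); apply: closure_subset.
by move=> _ [k _ <-]; apply: subsystem_shift.
Qed.

End Sequences.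

(** * Subsystems and minimality of X_eta *)

Section Dynamics.
Variable B : set nat.
Hypothesis B_pos : forall b, B b -> (0 < b)%N.
Hypothesis B_primitive : primitive B.
Hypothesis B_infinite : infinite_set B.
Implicit Types (S : {fset nat}) (n m k : int) (x y z : {ptws int -> bool}).

Lemma X_etaP x : X_eta B x <->
  forall s : seq int, exists k, forall n, n \in s -> x n = eta_seq B (n + k).
Proof.
rewrite /X_eta; split=> [/closure_ptwsP xs s|xs].
  by have [_ [k _ <-] kx] := xs s; exists k => n /kx <-.
apply/closure_ptwsP => s; have [k kx] := xs s.
by exists (shift_by k (eta_seq B)); [exists k|move=> n /kx].
Qed.

Lemma X_eta_eta : X_eta B (eta_seq B).
Proof. by apply/X_etaP => s; exists 0 => n _; rewrite addr0. Qed.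

Lemma X_eta_shift x k : X_eta B x -> X_eta B (shift_by k x).
Proof.
move=> /X_etaP xs; apply/X_etaP => s.
have [j jx] := xs [seq n + k | n <- s].
exists (k + j) => n ns; rewrite addrA -jx //.
by apply/mapP; exists n.
Qed.

Lemma subsystem_of_shifts N : closed N -> N !=set0 ->
  (forall x k, N x -> N (shift_by k x)) -> subsystem N.
Proof.
move=> Ncl N0 Ns; split=> //; apply/seteqP; split.
  by move=> _ [x Nx <-]; exact: Ns.
move=> x Nx; exists (shift_by (-1) x); first exact: Ns.
by rewrite /sigma shift_byD subrr shift_by0.
Qed.

Lemma subsystem_X_eta : subsystem (X_eta B).
Proof.
apply: subsystem_of_shifts; first exact: closed_closure.
  by exists (eta_seq B); exact: X_eta_eta.
exact: X_eta_shift.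
Qed.

Lemma free1 : free_numbers B 1.
Proof.
move=> [b Bb]; rewrite dvdzE dvdn1 absz_nat => /eqP b1.
by have := B_gt1 B_pos B_primitive B_infinite Bb; rewrite b1.
Qed.

Lemma eta_neq0 : eta_seq B <> zero_seq.
Proof. by move=> /(congr1 (fun x => x 1)); have /(eta_free B_pos) -> := free1. Qed.

Lemma eta_multiple b n : B b -> (b%:Z %| n)%Z -> eta_seq B n = false.
Proof. by move=> Bb bn; apply/negP => /(eta_free B_pos); apply; exists b. Qed.

Lemma card_X_eta : ~~ (X_eta B #<= `I_1)%card.
Proof.
apply/negP => /card_leP[f].
have [b Bb] := infinite_setN0 B_infinite.
(* This translate puts the multiple [b] at position 1, where [eta] has a free number. *)
pose y := shift_by (b%:Z - 1) (eta_seq B).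
have Xy : X_eta B y by apply: X_eta_shift; exact: X_eta_eta.
have f_cst u v : f u = f v.
  by apply: val_inj; have := valP (f u); have := valP (f v);
    rewrite !inE /= !ltnS !leqn0 => /eqP -> /eqP.
have Xy' : y \in X_eta B by rewrite inE.
have Xe : eta_seq B \in X_eta B by rewrite inE; exact: X_eta_eta.
have : y = eta_seq B.
  pose u : X_eta B := SigSub Xy'; pose v : X_eta B := SigSub Xe.
  have uv : u = v.
    by apply: (@inj _ _ _ f) (f_cst u v); apply: mem_set.
  by have := congr1 val uv.
move=> /(congr1 (fun x => x 1)); have /(eta_free B_pos) -> := free1.
by rewrite /y /shift_by addrC subrK (eta_multiple Bb) // dvdzz.
Qed.

Lemma minimal_M_eta : minimal_M B (eta_seq B) -> minimal_system (X_eta B).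
Proof.
(* The default value of [xget], the empty set, does not contain [eta]. *)
rewrite /minimal_M; case: xgetP => // N _ [NX Nsub Nmin] Neta.
have XN : X_eta B = N.
  by apply/seteqP; split=> //; exact: subsystem_orbit_closure.
by rewrite XN; split.
Qed.

Lemma minimal_system_M : minimal_system (X_eta B) -> X_eta B = minimal_M B.
Proof.
move=> [_ Xsub Xmin]; rewrite /minimal_M; case: xgetP => [N _ [NX Nsub _]|/(_ (X_eta B))].
  by rewrite (Xmin N).
by case; split.
Qed.

(** A point of [N] looks locally like a translate of [eta] by [k]; shifting it by some [j] congruent
    to [-k] modulo a common period of the positions in [s] restores [eta] there. *)
Lemma toeplitz_minimal : toeplitz (eta_seq B) -> minimal_system (X_eta B).
Proof.
move=> tp; split=> //; first exact: subsystem_X_eta.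
move=> N NX Nsub; apply/seteqP; split=> //.
apply: subsystem_orbit_closure => //.
have [Ncl [y Ny] _] := Nsub.
rewrite ((closure_id N).1 Ncl); apply/closure_ptwsP => s.
have [p p0 pP] : exists2 p : nat, (0 < p)%N &
    forall n, n \in s -> forall j, eta_seq B (n + j * p%:Z) = eta_seq B n.
  elim: s => [|n s [p p0 pP]]; first by exists 1%N.
  have [q q0 qP] := tp n; exists (p * q)%N; first by rewrite muln_gt0 p0.
  move=> m; rewrite inE => /orP[/eqP-> j|/pP mP j].
    by rewrite PoszM mulrA qP.
  by rewrite PoszM [p%:Z * _]mulrC mulrA mP.
have pz0 : p%:Z != 0 by rewrite eqz_nat -lt0n.
have /NX/X_etaP yX := Ny.
(* [j] depends on [k], so the window has to cover all shifts below [p] beforehand. *)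
pose t := [seq n + Posz i | n <- s, i <- iota 0 p].
have [k kt] := yX t.
pose j := `|((- k) %% p%:Z)%Z|%N.
have jE : j%:Z = ((- k) %% p%:Z)%Z by rewrite /j gez0_abs // modz_ge0.
have jp : (j < p)%N by rewrite -ltz_nat jE ltz_mod.
exists (shift_by j%:Z y); first exact: subsystem_shift.
move=> n ns; rewrite /shift_by kt; last first.
  by apply/allpairsP; exists (n, j); rewrite mem_iota.
have /dvdzP[q qE] : (p%:Z %| j%:Z + k)%Z.
  by rewrite -[k]opprK -eqz_mod_dvd jE modz_mod.
by rewrite -addrA qE pP.
Qed.

End Dynamics.

(** * Minimality excludes scaled coprime families when Delta(Z) is dense in W *)

Section Extension.
Variable B : set nat.
Hypothesis B_pos : forall b, B b -> (0 < b)%N.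
Hypothesis B_primitive : primitive B.
Hypothesis B_infinite : infinite_set B.
Hypothesis B_dense : closure (range (Delta B) `&` window B) = window B.
Implicit Types (S : {fset nat}) (n m k : int) (x y z : {ptws int -> bool}).

(* With [g = gcd(r, b)], the class of [r] modulo [b] contains [g] times a unit
   [v] of the profinite completion: [v] is [u = r / g] at the primes dividing
   [b / g] and [1] at all other primes.  By primitivity [g * v] lies in [W]. *)
Lemma window_residue b (r : nat) : B b -> ~~ (b %| r)%N ->
  exists2 h, window B h & agree [fset b]%fset h (Delta B r).
Proof.
move=> Bb br; have b0 := B_pos Bb.
have r0 : (0 < r)%N by case: (r) br; rewrite ?dvdn0.
pose g := gcdn r b; have g0 : (0 < g)%N by rewrite gcdn_gt0 r0.
pose u := (r %/ g)%N; pose m := (b %/ g)%N.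
have rE : r = (g * u)%N by rewrite mulnC divnK ?dvdn_gcdl.
have bE : b = (g * m)%N by rewrite mulnC divnK ?dvdn_gcdr.
have u0 : (0 < u)%N by move: r0; rewrite rE muln_gt0 => /andP[].
have m0 : (0 < m)%N by move: b0; rewrite bE muln_gt0 => /andP[].
have co_um : coprime u m.
  by rewrite /coprime -(eqn_pmul2l g0) muln_gcdr -rE -bE muln1.
pose pi : nat_pred := \pi(m).
pose v t : nat := (chinese t`_pi t`_pi^' u 1)%N.
have v_l t : v t = u %[mod (t`_pi)%N] by apply: chinese_modl; exact: coprime_partC.
have v_r t : v t = 1 %[mod (t`_pi^')%N] by apply: chinese_modr; exact: coprime_partC.
have v_dvd t t' : (0 < t')%N -> (t %| t')%N -> v t' = v t %[mod t].
  move=> t'0 tt'; have t0 := dvdn_gt0 t'0 tt'.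
  apply/eqP; suff : (v t' == v t %[mod t`_pi * t`_pi^'])%N by rewrite partnC.
  rewrite chinese_remainder ?coprime_partC //; apply/andP; split; apply/eqP.
    rewrite v_l -(modn_dvdm _ (partn_dvd pi t'0 tt')) v_l modn_dvdm //.
    exact: partn_dvd.
  rewrite v_r -(modn_dvdm _ (partn_dvd (pi^')%N t'0 tt')) v_r modn_dvdm //.
  exact: partn_dvd.
have v_co t : (0 < t)%N -> coprime t (v t).
  move=> t0; rewrite -{1}(partnC pi t0) coprimeMl; apply/andP; split.
    rewrite -coprime_modr v_l coprime_modr.
    apply: (@pnat_coprime pi); first exact: part_pnat.
    by rewrite -coprime_pi' // coprime_sym.
  by rewrite -coprime_modr v_r coprime_modr coprimen1.
pose h : residues B := fun c => Delta B (g * v (val c))%N%:Z c.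
exists h; last first.
  move=> c; rewrite inE => /eqP cb; rewrite /h; apply/Delta_eq => //.
  rewrite cb -eqz_mod_dvd; apply/eqP; rewrite !modz_nat; congr Posz.
  suff : (g * v b = g * u %[mod g * m])%N by rewrite -bE -rE.
  rewrite -!muln_modr; congr (_ * _)%N.
  have mb : (m %| b`_pi)%N.
    by rewrite -[m in (m %| _)%N](partn_pi m0) partn_dvd // bE dvdn_mull.
  by rewrite -(modn_dvdm _ mb) v_l modn_dvdm.
split.
  apply/group_HP => S SB; pose s := lcm_fset S.
  have s0 : (0 < s)%N := lcm_fset_gt0 B_pos SB.
  exists (g * v s)%N%:Z => c cS; rewrite /h; apply/Delta_eq => //.
  rewrite -eqz_mod_dvd; apply/eqP; rewrite !modz_nat; congr Posz.
  by rewrite -modnMmr -(v_dvd _ _ s0) ?dvdn_lcm_fset // modnMmr.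
move=> c; rewrite /h => /(Delta_eq0 B_pos); rewrite dvdz_nat.
have c0 := val_B_gt0 B_pos c.
(* As [v] is prime to [c], divisibility of [g * v] by [c] gives that of [g], hence of [b];
   primitivity yields [c = b], but then [b] divides [r]. *)
rewrite Gauss_dvdl ?v_co // => cg.
have cb : (val c %| b)%N by rewrite bE dvdn_mulr.
have /eqP cb' : val c == b.
  by apply/negPn/negP => /(B_primitive (val_B c) Bb); rewrite cb.
by move/negP: br; apply; rewrite -cb' rE dvdn_mulr.
Qed.

(** Density replaces the window point of [window_residue] by an integer. *)
Lemma free_residue b r : B b -> ~~ (b%:Z %| r)%Z ->
  exists2 n, free_numbers B n & (b%:Z %| n - r)%Z.
Proof.
move=> Bb br; have b0 := B_pos Bb; have bz0 : b%:Z != 0 by rewrite eqz_nat -lt0n.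
pose r' := `|(r %% b%:Z)%Z|%N.
have r'E : r'%:Z = (r %% b%:Z)%Z by rewrite /r' gez0_abs // modz_ge0.
have rr' : (b%:Z %| r'%:Z - r)%Z by rewrite -eqz_mod_dvd r'E modz_mod.
have br' : ~~ (b %| r')%N.
  apply: contra br; rewrite -dvdz_nat => br'.
  by rewrite -[r](subKr r'%:Z) rpredB.
have [h hW hr'] := window_residue Bb br'.
have SB : [set` [fset b]%fset] `<=` B.
  by move=> c /=; rewrite inE => /eqP ->.
move: hW; rewrite -B_dense => /closure_residuesP/(_ _ SB)[_ [[n _ <-] nW] hn].
exists n; first exact/(window_Delta B_pos).
rewrite -[n](subrK r'%:Z) -addrA rpredD //.
have bB : b \in B by rewrite inE.
apply/(Delta_eq B_pos n r' (SigSub bB)).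
by rewrite -hn ?hr' //= inE.
Qed.

Lemma minimal_not_scaled : minimal_system (X_eta B) -> ~ scaled_coprime B.
Proof.
move=> [_ Xsub Xmin] [d [A [d0 Ainf A1 Aco dAB]]].
have dz0 : d%:Z != 0 by rewrite eqz_nat -lt0n.
pose N := [set z | X_eta B z /\ exists c, forall n, z (c + d%:Z * n) = false].
have [y Ny] : N !=set0.
  pose Q (s : seq int) := [set k | (d%:Z %| k)%Z /\
    forall i, i \in s -> multiples B (k + d%:Z * i)].
  have Q0 s : Q s !=set0.
    have [k [m m0 km]] : exists k, exists2 m : nat, (0 < m)%N &
        forall i, i \in s -> exists2 a, A a & (a %| m)%N /\ (a%:Z %| k + i)%Z.
      elim: s => [|i s [k [m m0 km]]]; first by exists 0; exists 1%N.
      have [a Aa co] := coprime_of_infinite Ainf Aco m0.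
      have [u [v uv]] := Bezoutz a%:Z m%:Z.
      have uv1 : u * a%:Z + v * m%:Z = 1 by rewrite uv /gcdz !absz_nat (eqP co).
      (* The correction is a multiple of [m], so earlier divisibilities persist, and
         [u * a + v * m = 1] makes [a] divide the new value plus [i]. *)
      exists (k - v * (k + i) * m%:Z); exists (a * m)%N.
        by rewrite muln_gt0 m0 andbT ltnW // A1.
      move=> j; rewrite inE => /orP[/eqP->|/km[a' Aa' [a'm a'k]]].
        exists a => //; split; first exact: dvdn_mulr.
        have -> : k - v * (k + i) * m%:Z + i = (k + i) * u * a%:Z.
          have ua : u * a%:Z = 1 - v * m%:Z by rewrite -uv1 addrK.
          by rewrite -[RHS]mulrA ua; ring.
        by rewrite dvdz_mull.
      exists a' => //; split; first exact: dvdn_mull.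
      by rewrite addrAC rpredB // dvdz_mull // dvdz_nat.
    exists (d%:Z * k); split; first by rewrite dvdz_mulr.
    move=> i /km[a Aa [_ ak]]; exists (d * a)%N; first by apply: dAB; exists a.
    by rewrite -mulrDr PoszM dvdz_mul.
  have FF : ProperFilter (filter_from setT Q).
    apply: filter_from_proper => //; apply: filter_from_filter; first by exists [::].
    move=> s t _ _; exists (s ++ t) => // k [dk kst].
    by split; split=> // i ist; apply: kst; rewrite mem_cat ist ?orbT.
  have [y yP] := orbit_limit (eta_seq B) FF.
  exists y; split.
    apply/X_etaP => s; have [|k _ ks] := yP s setT; first exact: filterT.
    by exists k.
  exists 0 => n; rewrite add0r.
  have [|k [_ kn] ->] := yP [:: d%:Z * n] (Q [:: n]); rewrite ?mem_head //.
    by exists [:: n].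
  have [b Bb bk] := kn n (mem_head _ _).
  by apply: (eta_multiple B_pos Bb); rewrite addrC.
have Nsub : subsystem N.
  apply: subsystem_of_shifts; last first.
  - move=> z k [Xz [c zc]]; split; first exact: X_eta_shift.
    by exists (c - k) => n; rewrite /shift_by addrAC subrK zc.
  - by exists y.
  move=> z /closure_ptwsP zN; split.
    apply/X_etaP => s; have [w [/X_etaP/(_ s)[k kw] _] wz] := zN s.
    by exists k => n ns; rewrite -wz // kw.
  apply: contrapT => nc.
  (* Closedness: if [z] vanished on no class modulo [d], finitely many positions, one per class,
     would show it, also for an approximating point of [N]. *)
  have /choice[f fP] c : exists n, z (c + d%:Z * n) = true.
    apply: contrapT => nn; apply: nc; exists c => n.
    by apply/negP => zn; apply: nn; exists n.
  have [w [_ [c wc]] wz] := zN [seq Posz c + d%:Z * f (Posz c) | c <- iota 0 d].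
  pose c' := `|(c %% d%:Z)%Z|%N.
  have c'E : c'%:Z = (c %% d%:Z)%Z by rewrite /c' gez0_abs // modz_ge0.
  have c'd : (c' < d)%N by rewrite -ltz_nat c'E ltz_mod.
  have := fP c'; rewrite -wz; last by apply/mapP; exists c'; rewrite ?mem_iota.
  have -> : c'%:Z + d%:Z * f c' = c + d%:Z * (f c' - (c %/ d%:Z)%Z).
    move: (f c') => e; rewrite c'E.
    have -> : (c %% d%:Z)%Z = c - (c %/ d%:Z)%Z * d%:Z.
      by rewrite [X in X - _](divz_eq c d%:Z) addrC addKr.
    ring.
  by rewrite wc.
have NX : N = X_eta B by apply: Xmin => // z [].
have [_ [c etac]] : N (eta_seq B) by rewrite NX; exact: X_eta_eta.
have [a Aa] := infinite_setN0 Ainf.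
have Bb : B (d * a)%N by apply: dAB; exists a.
(* Since [a > 1], [c] and [c + d] are not both multiples of [d * a]. *)
have [r dr nr] : exists2 r, (d%:Z %| r - c)%Z & ~~ ((d * a)%N%:Z %| r)%Z.
  have [bc|] := boolP ((d * a)%N%:Z %| c)%Z; last by exists c; rewrite ?subrr.
  exists (c + d%:Z); first by rewrite [c + _]addrC addrK.
  rewrite rpredDl //; apply/negP; rewrite dvdz_nat => /dvdn_leq -/(_ d0).
  by rewrite -{2}[d]muln1 leq_pmul2l // leqNgt A1.
have [n nF bn] := free_residue Bb nr.
have /dvdzP[q nE] : (d%:Z %| n - c)%Z.
  rewrite -[n](subrK r) -addrA rpredD //.
  by apply: dvdz_trans bn; rewrite dvdz_nat dvdn_mulr.
have := etac q; rewrite [d%:Z * q]mulrC -nE addrC subrK => /negP; apply.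
exact/(eta_free B_pos).
Qed.

End Extension.

(** * The almost one-to-one extension *)

Section AlmostOneToOne.
Variable B : set nat.
Hypothesis B_pos : forall b, B b -> (0 < b)%N.
Hypothesis B_primitive : primitive B.
Hypothesis B_infinite : infinite_set B.
Hypothesis B_dense : closure (range (Delta B) `&` window B) = window B.
Hypothesis B_free : locally_free B.
Implicit Types (S : {fset nat}) (n m k : int) (x y z : {ptws int -> bool}).

(* The class of [- k] modulo [b] is the only one on which the window
   [0, width b) of the translate by [k] of [eta] vanishes. *)
Lemma recognition_width : exists width : nat -> nat, forall b, B b ->
  forall r k, ~~ (b%:Z %| r)%Z -> exists2 t : nat, (t < width b)%N &
    (b%:Z %| t%:Z + k - r)%Z /\ eta_seq B (t%:Z + k).
Proof.
suff H b : exists w : nat, B b -> forall r k, ~~ (b%:Z %| r)%Z ->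
    exists2 t : nat, (t < w)%N & (b%:Z %| t%:Z + k - r)%Z /\ eta_seq B (t%:Z + k).
  by have /choice[w wP] := H; exists w.
have [Bb|] := pselect (B b); last by exists 0%N.
have b0 := B_pos Bb; have bz0 : b%:Z != 0 by rewrite eqz_nat -lt0n.
have step (r : nat) : exists w : nat, ~~ (b %| r)%N -> forall k,
    exists2 t : nat, (t < w)%N & (b%:Z %| t%:Z + k - r%:Z)%Z /\ eta_seq B (t%:Z + k).
  have [br|br] := boolP (b %| r)%N; first by exists 0%N.
  have brz : ~~ (b%:Z %| r%:Z)%Z by rewrite dvdz_nat.
  have [n nF bn] := free_residue B_pos B_primitive B_dense Bb brz.
  have [p p0 pP] := locally_free_toeplitz B_pos B_free n.
  have w0 : (0 < p * b)%N by rewrite muln_gt0 p0.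
  have wz0 : (p * b)%N%:Z != 0 by rewrite eqz_nat -lt0n.
  (* If [t + k] is congruent to [n] modulo [p * b], it lies in the class of [r] modulo [b], and
     [eta] takes there the same value as at the free [n]. *)
  exists (p * b)%N => _ k.
  pose t := `|((n - k) %% (p * b)%N%:Z)%Z|%N.
  have tE : t%:Z = ((n - k) %% (p * b)%N%:Z)%Z by rewrite /t gez0_abs // modz_ge0.
  exists t; first by rewrite -ltz_nat tE ltz_mod.
  have /dvdzP[q tn] : ((p * b)%N%:Z %| t%:Z - (n - k))%Z.
    by rewrite -eqz_mod_dvd tE modz_mod.
  have {}tn : t%:Z + k = n + q * b%:Z * p%:Z.
    by move/eqP: tn; rewrite subr_eq => /eqP ->; rewrite PoszM; ring.
  split; last by rewrite tn pP; apply/(eta_free B_pos).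
  rewrite tn; have -> : n + q * b%:Z * p%:Z - r%:Z = (n - r%:Z) + q * p%:Z * b%:Z by ring.
  by rewrite rpredD // dvdz_mull.
have /choice[w wP] := step.
exists (\max_(r < b) w r)%N => _ r k br.
pose r' := `|(r %% b%:Z)%Z|%N.
have r'E : r'%:Z = (r %% b%:Z)%Z by rewrite /r' gez0_abs // modz_ge0.
have r'b : (r' < b)%N by rewrite -ltz_nat r'E ltz_mod.
have rr' : (b%:Z %| r'%:Z - r)%Z by rewrite -eqz_mod_dvd r'E modz_mod.
have br' : ~~ (b %| r')%N.
  apply: contra br; rewrite -dvdz_nat => br'.
  by rewrite -[r](subKr r'%:Z) rpredB.
have [t tw [bt et]] := wP r' br' k.
exists t; first by apply: leq_trans tw (leq_bigmax (Ordinal r'b)).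
split=> //; have -> : t%:Z + k - r = (t%:Z + k - r'%:Z) + (r'%:Z - r) by ring.
by rewrite rpredD.
Qed.

(** The factor map reads off, for each [b], the class modulo [b] of the translation by which a point
    locally arises from [eta]. A finite window suffices, whence continuity. *)
Lemma almost_11_extension : minimal_almost_11_extension B.
Proof.
split; first exact/toeplitz_minimal/(locally_free_toeplitz B_pos B_free).
have [width widthP] := recognition_width.
pose J b : seq int := [seq Posz t | t <- iota 0 (width b)].
pose vanish x b c := forall t : nat, (t < width b)%N -> (b%:Z %| t%:Z + c)%Z ->
  x t%:Z = false.
(* On [X_eta] a suitable [c] always exists, so the default 0 is not taken there. *)
pose pi x : residues B :=
  fun b => Delta B (xget 0 [set c | vanish x (val b) c]) b.
have piE x k b : (forall n, n \in J (val b) -> x n = eta_seq B (n + k)) ->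
    pi x b = Delta B k b.
  move=> xk; have {}xk t : (t < width (val b))%N -> x t%:Z = eta_seq B (t%:Z + k).
    by move=> tw; apply: xk; apply/mapP; exists t; rewrite ?mem_iota.
  have Bb := val_B b.
  have vk : vanish x (val b) k.
    by move=> t tw bt; rewrite xk // (eta_multiple B_pos Bb).
  rewrite /pi; case: xgetP => [c _ vc|/(_ k)//].
  apply/(Delta_eq B_pos); rewrite -opprB dvdzNr; apply/negPn/negP => bkc.
  have [t tw [bt et]] := widthP _ Bb _ k bkc.
  have := vc t tw; rewrite xk // et => vt.
  suff /vt : ((val b)%:Z %| t%:Z + c)%Z by [].
  by have -> : t%:Z + c = t%:Z + k - (k - c) by ring.
pose JS S : seq int := flatten [seq J b | b <- enum_fset S].
have JSP S n (b : nat) : b \in S -> n \in J b -> n \in JS S.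
  by move=> bS nb; apply/flattenP; exists (J b) => //; apply/mapP; exists b.
have piS x k S : (forall n, n \in JS S -> x n = eta_seq B (n + k)) ->
    agree S (pi x) (Delta B k).
  by move=> xk b bS; apply: piE => n nb; apply: xk; apply: JSP nb.
have fset1B (b : B) : [set` [fset val b]%fset] `<=` B.
  by move=> c /=; rewrite inE => /eqP ->; exact: val_B.
exists pi; split.
- apply/subspace_continuousP => x Xx A /nbhs_residues[S SB SA].
  apply/nbhs_ptws_bool; exists (JS S) => y yx Xy; apply: SA.
  have [k kx] := (X_etaP B x).1 Xx (JS S).
  apply: (agree_trans (piS _ _ _ kx)); apply/agree_sym/piS => n nS.
  by rewrite yx // kx.
- apply/seteqP; split=> [_ [x Xx <-]|h hH].
    apply/group_HP => S SB; have [k kx] := (X_etaP B x).1 Xx (JS S).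
    by exists k; exact: piS.
  (* Surjectivity: translates of [eta] by integers [k] with [Delta k] tending to [h] have a limit
     point above [h]. *)
  pose Q S := [set k | agree S h (Delta B k)].
  have FF : ProperFilter (filter_from [set S : {fset nat} | [set` S] `<=` B] Q).
    apply: filter_from_proper; last first.
      by move=> S SB; have [k hk] := (group_HP h).1 hH S SB; exists k.
    apply: filter_from_filter; first by exists fset0.
    move=> S S' SB S'B; exists (S `|` S')%fset.
      by move=> c /=; rewrite inE => /orP[/SB|/S'B].
    by move=> k hk; split; apply: agree_sub hk => c cS; rewrite inE cS ?orbT.
  have [x xP] := orbit_limit (eta_seq B) FF.
  exists x.
    apply/X_etaP => s; have [|k _ ks] := xP s setT; first exact: filterT.
    by exists k.
  apply/functional_extensionality_dep => b.
  have [|k hk kx] := xP (J (val b)) (Q [fset val b]%fset).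
    by exists [fset val b]%fset => //; exact: fset1B.
  by rewrite (piE _ _ _ kx) hk // inE.
- move=> x; rewrite inE => Xx; apply/functional_extensionality_dep => b.
  (* The enlarged window lets one [k] serve both [x] and its shift. *)
  have [k kx] := (X_etaP B x).1 Xx (J (val b) ++ [seq n + 1 | n <- J (val b)]).
  rewrite (piE _ (k + 1)); last first.
    move=> n nJ; rewrite /sigma /shift_by kx; first by congr (eta_seq B _); ring.
    by rewrite mem_cat; apply/orP; right; apply/mapP; exists n.
  rewrite DeltaD //.
  have rotE h : rotation h b =
      (h b : 'I_(val b).-1.+1) + (Delta B 1 b : 'I_(val b).-1.+1) by [].
  rewrite rotE (piE _ k) // => n nJ; apply: kx.
  by rewrite mem_cat nJ.
(* The fibre over 0 is reduced to [eta]: at each position its points take the value of [eta]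
   translated by a multiple of [lcm S], or of [b], which leaves that value unchanged. *)
exists 0; first by rewrite -(Delta0 B); exact: Delta_group_H.
exists (eta_seq B); apply/seteqP; split=> [x [Xx pix]|_ ->]; last first.
  split; first exact: X_eta_eta.
  apply/functional_extensionality_dep => b.
  by rewrite (piE _ 0) ?Delta0 // => n _; rewrite addr0.
have pi0 b : pi x b = (0 : 'I_(val b).-1.+1) by rewrite pix.
apply/funext => n.
have [nF|/contrapT nM] := pselect (free_numbers B n).
  have [S SB nS] := B_free nF.
  have [k kx] := (X_etaP B x).1 Xx (n :: JS S).
  rewrite kx ?mem_head //; apply: eta_eq => //; split=> // _.
  have : agree S (Delta B k) (Delta B 0).
    rewrite Delta0 -pix; apply/agree_sym/piS => m mS.
    by apply: kx; rewrite inE mS orbT.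
  move=> /(agree_Delta B_pos _ _ SB); rewrite subr0 => /dvdzP[q ->].
  exact: ((free_A_P B S n).1 nS).
have [b bn] := (multiplesP B n).1 nM.
have [k kx] := (X_etaP B x).1 Xx (n :: J (val b)).
have bk : ((val b)%:Z %| k)%Z.
  apply/(Delta_eq0 B_pos); rewrite -(pi0 b); symmetry; apply: piE => m mJ.
  by apply: kx; rewrite inE mJ orbT.
rewrite kx ?mem_head // !(eta_multiple B_pos (val_B b)) //.
by rewrite rpredD.
Qed.

End AlmostOneToOne.

(** * Assembly of the equivalences and implications *)

Theorem theoremB (R : realType) (B : set nat)
    (B_pos : forall b, B b -> (0 < b)%N)
    (B_infinite : infinite_set B)
    (B_primitive : primitive B) :
  let B1 := closure (int_window B) = window B in
  let B2 := free_numbers B =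
            \bigcup_(S in [set S : {fset nat} | [set` S] `<=` B])
              free_numbers (A_ B S) in
  let B3 := A_infty B = set0 in
  let B4 := ~ exists (d : nat) (A : set nat),
              [/\ (0 < d)%N,
                  infinite_set A,
                  forall a, A a -> (1 < a)%N,
                  pairwise_coprime A
                & [set (d * a)%N | a in A] `<=` B] in
  let B5 := toeplitz (eta_seq B) /\ eta_seq B <> zero_seq in
  let B6 := C_phi B 0 /\ phi (0 : residues B) <> zero_seq in
  let B7 := minimal_M B (eta_seq B) /\ eta_seq B <> zero_seq in
  let B8 := [/\ minimal_system (X_eta B),
                X_eta B = minimal_M B
              & ~~ (X_eta B #<= `I_1)%card] in
  let B9 := minimal_almost_11_extension B in
  [/\ [<-> B1; B2; B3; B4; B5; B6] /\
        [/\ B1 -> taut R B, B2 -> taut R B & B3 -> taut R B] /\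
        [/\ B4 -> taut R B, B5 -> taut R B & B6 -> taut R B],
      B7 <-> B8,
      [/\ B1 -> B9, B2 -> B9 & B3 -> B9] /\
        [/\ B4 -> B9, B5 -> B9 & B6 -> B9],
      B9 -> B7 /\ B8
    & (taut R B -> closure (range (Delta B) `&` window B) = window B) /\
      (closure (range (Delta B) `&` window B) = window B ->
       [<-> B1; B2; B3; B4; B5; B6; B7; B8; B9])].
Proof.
move=> B1 B2 B3 B4 B5 B6 B7 B8 B9.
have B0 : B !=set0 := infinite_setN0 B_infinite.
have eta0 := eta_neq0 B_pos B_primitive B_infinite.
have B2E : B2 <-> locally_free B := locally_freeP B.
have ns_lf : B4 -> locally_free B.
  by move=> /(not_scaled_A_infty B_pos) /(A_infty_locally_free B0).
have lf_ns : locally_free B -> B4 := locally_free_not_scaled B_pos B_primitive.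
have lf_taut : locally_free B -> taut R B.
  by move=> /lf_ns; exact: not_scaled_taut.
have taut_d : taut R B -> closure (range (Delta B) `&` window B) = window B.
  exact: taut_dense.
have b1 : B1 <-> locally_free B.
  split; first by move=> /(regular_not_scaled B_pos B_primitive) /ns_lf.
  by move=> lf; exact: (locally_free_regular B_pos lf (taut_d (lf_taut lf))).
have b3 : B3 <-> locally_free B.
  split; first exact: A_infty_locally_free.
  by move=> /lf_ns; exact: not_scaled_A_infty.
have b4 : B4 <-> locally_free B by split.
have b5 : B5 <-> locally_free B.
  split=> [[/(toeplitz_locally_free B_pos)]//|lf].
  by split=> //; exact: locally_free_toeplitz.
have b6 : B6 <-> locally_free B.
  split=> [[/(C_phi_locally_free B_pos)]//|lf].
  by split=> //; exact: locally_free_C_phi.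
have b8E : B8 <-> minimal_system (X_eta B).
  split=> [[]//|Xmin]; split=> //; first exact: minimal_system_M.
  exact: card_X_eta.
have b78 : B7 <-> B8.
  split=> [[etaM _]|[_ XM _]]; first exact/b8E/minimal_M_eta.
  by split=> //; rewrite -XM; exact: X_eta_eta.
have b9 : locally_free B -> B9.
  by move=> lf; exact: (almost_11_extension B_pos B_primitive (taut_d (lf_taut lf)) lf).
have b98 : B9 -> B8 by case=> Xmin _; apply/b8E.
(* This closes the cycle of part e): with density, minimality already gives (B4). *)
have d8 : closure (range (Delta B) `&` window B) = window B -> B8 -> locally_free B.
  move=> dense /b8E Xmin; apply/ns_lf.
  exact: (minimal_not_scaled B_pos B_primitive dense Xmin).
split=> //.
- split; last by split; split=> ?; apply: lf_taut; tauto.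
  by tfae; tauto.
- by split; split=> ?; apply: b9; tauto.
- by move=> /b98 h8; split=> //; apply/b78.
- by split=> // /d8 h8; tfae; tauto.
Qed.
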